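(* Let $\mathcal{H}$ be a supersolvable hyperplane arrangement and let $R_0$ be a canonical region of $\mathcal{H}$ (with respect to a fixed recursive supersolvable decomposition). Then the poset of regions $L:=P(\mathcal{H},R_0)$ is a lattice, and for any lattice congruence $\equiv$ on $L$, the cover graph of the quotient lattice $L/\equiv$ has a Hamiltonian path.
   Context: A hyperplane arrangement in $\mathbb{R}^d$ is a finite set $\mathcal{H}$ of linear hyperplanes; its rank is the dimension of the span of the normal vectors. Regions are the connected components of the complement of $\bigcup\mathcal{H}$; the graph of regions $G(\mathcal{H})$ has the regions as vertices, two being adjacent iff separated by exactly one hyperplane of $\mathcal{H}$ ($G(\mathcal{H})$ is connected and bipartite). An arrangement of rank $n$ is supersolvable if $n\le 2$, or $n\ge 3$ and $\mathcal{H}=\mathcal{H}_0\sqcup\mathcal{H}_1$ with $\mathcal{H}_0,\mathcal{H}_1$ nonempty, $\mathcal{H}_0$ supersolvable of rank $n-1$, and for any distinct $H',H''\in\mathcal{H}_1$ there is $H\in\mathcal{H}_0$ with $H'\cap H''\subseteq H$. For such a decomposition, let $\rho$ map each region of $\mathcal{H}$ to the region of $\mathcal{H}_0$ containing it; for each region $R$ of $\mathcal{H}$, the set $\rho^{-1}(\rho(R))$ induces a path in $G(\mathcal{H})$. Canonical regions: if the rank is at most $2$, every region is canonical; if the rank is $\ge3$, a region $R_0$ is canonical if $\rho(R_0)$ is canonical for $\mathcal{H}_0$ (with respect to its own decomposition) and $R_0$ is the first or last vertex of the path induced by $\rho^{-1}(\rho(R_0))$ in $G(\mathcal{H})$. The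 poset of regions $P(\mathcal{H},R_0)$ has the regions as ground set, the rank of a region $R$ being its graph distance from $R_0$ in $G(\mathcal{H})$, covers being the edges of $G(\mathcal{H})$ oriented from lower to higher rank, and the order being the reflexive-transitive closure of the covers. A lattice congruence on a lattice $L$ is an equivalence relation $\equiv$ such that $x\equiv x'$ and $y\equiv y'$ imply $x\wedge y\equiv x'\wedge y'$ and $x\vee y\equiv x'\vee y'$; the quotient lattice $L/\equiv$ is the set of classes, ordered by $X\le Y$ iff there are $x\in X$, $y\in Y$ with $x\le y$. The cover graph of a poset has its elements as vertices and its cover pairs as edges. *)

(* Defs.v *)
From mathcomp Require Import all_boot all_order all_algebra.
From mathcomp Require Import boolp reals.
Set Implicit Arguments. Unset Strict Implicit. Unset Printing Implicit Defensive.
Import Order.TTheory GRing.Theory Num.Theory.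
Local Open Scope ring_scope.

Section Arrangements.
Variables (R : realType) (d m : nat) (a : 'I_m -> 'rV[R]_d).

Definition dotv (u x : 'rV[R]_d) : R := \sum_(k < d) u ord0 k * x ord0 k.

(* a : 'I_m -> 'rV_d lists the normal vectors of the hyperplanes
   H_i = {x | <a i, x> = 0}; they must be genuine, pairwise distinct
   linear hyperplanes. *)
Definition arrangement : Prop :=
  (forall i, a i != 0) /\
  (forall i j, i != j -> exists x, (dotv (a i) x == 0) != (dotv (a j) x == 0)).

Definition arr_rank (S : {set 'I_m}) : nat :=
  \rank (\matrix_(i < m) (if i \in S then a i else 0) : 'M[R]_(m, d)).

Definition cell (S : {set 'I_m}) (sigma : {ffun 'I_m -> bool}) (x : 'rV[R]_d) : Prop :=
  forall i, i \in S -> dotv (a i) x != 0 /\ (0 < dotv (a i) x) = sigma i.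

(* A region of the subarrangement S (a connected component of the complement
   of the union of the H_i, i in S) is represented by its sign vector on S,
   normalized to false outside S. *)
Definition is_region (S : {set 'I_m}) (sigma : {ffun 'I_m -> bool}) : Prop :=
  (forall i, i \notin S -> sigma i = false) /\ exists x, cell S sigma x.

Definition regions (S : {set 'I_m}) : {set {ffun 'I_m -> bool}} :=
  [set sigma | `[< is_region S sigma >]].

Definition adj (S : {set 'I_m}) : rel {ffun 'I_m -> bool} :=
  fun s t => [&& s \in regions S, t \in regions S &
                 #|[set i in S | s i != t i]| == 1%N].

(* Supersolvable decomposition chain: S = A_n, ch = [:: A_{n-1}; ...; A_2]. *)
Fixpoint ss_chain (S : {set 'I_m}) (ch : seq {set 'I_m}) : Prop :=
  match ch with
  | [::] => (arr_rank S <= 2)%N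
  | S0 :: ch' =>
      [/\ (3 <= arr_rank S)%N, S0 \proper S, S0 != set0
        & arr_rank S0 = (arr_rank S).-1] /\
      [/\ 
          (forall i j, i \in S :\: S0 -> j \in S :\: S0 -> i != j ->
             exists2 k, k \in S0 &
               forall x, dotv (a i) x = 0 -> dotv (a j) x = 0 -> dotv (a k) x = 0)
        & ss_chain S0 ch']
  end.

Definition supersolvable (S : {set 'I_m}) : Prop := exists ch, ss_chain S ch.

(* rho : the region of S0 containing the region sigma of S. *)
Definition restr (S0 : {set 'I_m}) (sigma : {ffun 'I_m -> bool}) : {ffun 'I_m -> bool} :=
  [ffun i => (i \in S0) && sigma i].

(* Canonical regions w.r.t. the fixed decomposition chain.  Being the first or
   last vertex of the path induced by the fibre rho^{-1}(rho(sigma)) means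
   having at most one neighbour inside the fibre. *)
Fixpoint canonical_region (S : {set 'I_m}) (ch : seq {set 'I_m})
    (sigma : {ffun 'I_m -> bool}) : Prop :=
  match ch with
  | [::] => True
  | S0 :: ch' =>
      canonical_region S0 ch' (restr S0 sigma) /\
      (#|[set t | adj S sigma t & restr S0 t == restr S0 sigma]| <= 1)%N
  end.

End Arrangements.

Section Generic.
Variable T : finType.

Definition walk (e : rel T) (x y : T) (n : nat) : Prop :=
  exists p : seq T, [/\ size p = n, path e x p & last x p = y].

Definition is_dist (e : rel T) (x y : T) (n : nat) : Prop :=
  walk e x y n /\ forall k, walk e x y k -> (n <= k)%N.

(* Covers of the poset of regions P(H, x0): edges of G oriented from lower
   to higher rank, the rank being the graph distance from x0. *)
Definition rank_cover (e : rel T) (x0 : T) : rel T :=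
  fun x y => `[< e x y /\ exists n1 n2,
                 [/\ is_dist e x0 x n1, is_dist e x0 y n2 & (n1 < n2)%N] >].

Definition rank_le (e : rel T) (x0 : T) : rel T := connect (rank_cover e x0).

Definition is_poset (V : {set T}) (le : rel T) : Prop :=
  [/\ {in V, forall x, le x x},
      {in V &, forall x y, le x y -> le y x -> x = y}
    & {in V & V & V, forall x y z, le x y -> le y z -> le x z}].

Definition is_lub (V : {set T}) (le : rel T) (x y z : T) : Prop :=
  [/\ z \in V, le x z, le y z & {in V, forall w, le x w -> le y w -> le z w}].

Definition is_glb (V : {set T}) (le : rel T) (x y z : T) : Prop :=
  [/\ z \in V, le z x, le z y & {in V, forall w, le w x -> le w y -> le w z}].

Definition is_lattice (V : {set T}) (le : rel T) : Prop :=
  is_poset V le /\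
  {in V &, forall x y, (exists z, is_lub V le x y z) /\ (exists z, is_glb V le x y z)}.

Definition is_equiv_on (V : {set T}) (eqv : rel T) : Prop :=
  [/\ {in V, forall x, eqv x x},
      {in V &, forall x y, eqv x y -> eqv y x}
    & {in V & V & V, forall x y z, eqv x y -> eqv y z -> eqv x z}].

Definition lattice_congruence (V : {set T}) (le eqv : rel T) : Prop :=
  is_equiv_on V eqv /\
  forall x x' y y', x \in V -> x' \in V -> y \in V -> y' \in V ->
    eqv x x' -> eqv y y' ->
    (forall z z', is_glb V le x y z -> is_glb V le x' y' z' -> eqv z z') /\
    (forall z z', is_lub V le x y z -> is_lub V le x' y' z' -> eqv z z').

Definition classes (V : {set T}) (eqv : rel T) : {set {set T}} :=
  [set [set y in V | eqv x y] | x in V].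

Definition qle (le : rel T) (X Y : {set T}) : bool :=
  [exists x in X, exists y in Y, le x y].

Definition qlt (le : rel T) (X Y : {set T}) : bool := (X != Y) && qle le X Y.

Definition qcover (V : {set T}) (le eqv : rel T) (X Y : {set T}) : bool :=
  [&& X \in classes V eqv, Y \in classes V eqv, qlt le X Y &
      ~~ [exists Z in classes V eqv, qlt le X Z && qlt le Z Y]].

Definition hamiltonian_path (U : finType) (W : {set U}) (e : rel U) : Prop :=
  exists (x0 : U) (s : seq U),
    [/\ uniq (x0 :: s), (forall X, (X \in x0 :: s) = (X \in W))
      & path (fun X Y => e X Y || e Y X) x0 s].

End Generic.

(* Main.v *)
Require Import Defs.
From mathcomp Require Import all_boot all_order all_algebra.
From mathcomp Require Import boolp reals.
From mathcomp Require Import ring lra.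
Set Implicit Arguments. Unset Strict Implicit. Unset Printing Implicit Defensive.

(** Regions are ordered by inclusion of their sets of separating hyperplanes from
    the base region.  For a modular step [S0 < S] there is a direction [v] parallel to
    the hyperplanes of [S0] and transverse to the others; lines parallel to [v]
    cross the hyperplanes of [S :\: S0] in an order depending only on the region
    of [S0].  Regions of [S] are thus pairs (region [Q] of [S0], initial segment of
    the crossing order at [Q]), and joins are obtained by closing the union of two
    segments downwards for the crossing order at the join of the two base regions;
    replacing [v] by [-v] gives meets.

    For a congruence on the lattice [L] of [S], let [P ~ Q] on the lattice [L0] of [S0]
    when the bottoms of the fibres over [P] and [Q] are congruent (equivalently, the
    tops are).  This is a congruence, and the classes of [L] over a class of [L0] form a
    saturated chain from a class of bottoms to a class of tops.  Since both
    bottoms and tops over adjacent classes of [L0] are adjacent, a Hamiltonian path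
    of the quotient of [L0] lifts by traversing these chains alternately upwards and
    downwards.  Rank at most 2 fits the same scheme, through the empty
    arrangement and one wall of the base region. *)

(** * Finite strict chains and the paths formed by their covers *)

Section Chains.
Variables (U : finType) (W : {set U}) (lt : rel U).
Hypothesis ltxx : {in W, forall x, ~~ lt x x}.
Hypothesis lt_tr : {in W & &, forall y x z, lt x y -> lt y z -> lt x z}.
Hypothesis lt_tot : {in W &, forall x y, x != y -> lt x y || lt y x}.

(** The prefix [p] keeps all of [W] in view during the induction on [s]: an element strictly between
    [x] and its successor would occur in the list, yet everything in [p] is below [x] and everything
    further right is above the successor. *)
Lemma pairwise_cover_path p x s :
  pairwise lt (p ++ x :: s) -> (forall z, (z \in p ++ x :: s) = (z \in W)) ->
  path (fun X Y => lt X Y && ~~ [exists Z in W, lt X Z && lt Z Y]) x s.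
Proof.
elim: s p x => [//|y s IH] p x Hp Hm /=.
have Hp' : pairwise lt (rcons p x ++ y :: s) by rewrite cat_rcons.
have Hm' z : (z \in rcons p x ++ y :: s) = (z \in W) by rewrite cat_rcons Hm.
rewrite (IH (rcons p x)) // andbT.
move: Hp; rewrite pairwise_cat /= => /and3P[/allrelP Hpx _ /andP[/= /andP[Hxy Hxs] /andP[Hys _]]].
rewrite Hxy /=; apply/existsP => -[z /and3P[zW xz zy]].
have xW : x \in W by rewrite -Hm mem_cat mem_head orbT.
have yW : y \in W by rewrite -Hm' mem_cat mem_head orbT.
move: (zW); rewrite -Hm mem_cat !in_cons => /or4P[zp|/eqP zx|/eqP zY|zs].
- by have := lt_tr zW xW xW xz (Hpx _ _ zp (mem_head _ _)); rewrite (negbTE (ltxx xW)).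
- by move: xz; rewrite zx (negbTE (ltxx xW)).
- by move: zy; rewrite zY (negbTE (ltxx yW)).
- have yz := allP Hys _ zs.
  by have := lt_tr yW zW zW zy yz; rewrite (negbTE (ltxx zW)).
Qed.

Lemma chain_cover_path (bot top : U) :
  bot \in W -> top \in W ->
  {in W, forall x, x != bot -> lt bot x} -> {in W, forall x, x != top -> lt x top} ->
  exists s, [/\ uniq (bot :: s), (forall z, (z \in bot :: s) = (z \in W)), last bot s = top
   & path (fun X Y => lt X Y && ~~ [exists Z in W, lt X Z && lt Z Y]) bot s].
Proof.
move=> bW tW botP topP.
(* Sorting needs a total, hence reflexive, relation; strictness is recovered afterwards because the
   sorted list has no repetition. *)
pose r x y := (x == y) || lt x y.
have r_tr : {in W & &, transitive r}.
  move=> y x z yW xW zW; rewrite /r => /orP[/eqP-> //|xy] /orP[/eqP<-|yz].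
    by rewrite xy orbT.
  by rewrite (lt_tr yW xW zW xy yz) orbT.
have r_tot : {in W &, total r}.
  move=> x y xW yW; rewrite /r; case: eqVneq => //= ne.
  by have /orP[->|->] := lt_tot xW yW ne; rewrite ?orbT.
pose l := sort r (enum W).
have lW z : (z \in l) = (z \in W) by rewrite mem_sort mem_enum.
have lu : uniq l by rewrite sort_uniq enum_uniq.
have allW : all (mem W) l by apply/allP => z; rewrite lW.
have srt : sorted r l.
  apply: (sort_sorted_in (P := mem W)) => //.
  by apply/allP => z; rewrite mem_enum.
have pw : pairwise r l by rewrite -(sorted_pairwise_in (P := mem W)).
have {pw} pw : pairwise lt l.
  elim: (l) lu pw => //= x s IH /andP[xs us] /andP[xr pr].
  rewrite IH // andbT; apply/allP => z zs; have := allP xr z zs.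
  by rewrite /r; case: eqP => // xz; move: xs; rewrite xz zs.
case El : l => [|x s].
  by move: (lW bot); rewrite El bW.
have xb : x = bot.
  apply/eqP; case: eqVneq => // ne.
  have xW : x \in W by rewrite -lW El mem_head.
  have bx := botP _ xW ne.
  move: (lW bot); rewrite El bW in_cons eq_sym (negbTE ne) /= => bs.
  move: pw; rewrite El /= => /andP[/allP/(_ _ bs) xb _].
  by have := lt_tr bW xW xW xb bx; rewrite (negbTE (ltxx xW)).
rewrite {x}xb in El.
exists s; split; first by rewrite -El.
- by move=> z; rewrite -El lW.
- apply/eqP; case: eqVneq => // ne.
  have LW : last bot s \in W by rewrite -lW El mem_last.
  have Lt := topP _ LW ne.
  move: pw ne LW Lt (lW top); rewrite tW El; case: (lastP s) => [|s' y].
    by rewrite /= !inE => _ /negP ne _ _ /eqP tb; case: ne; rewrite tb.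
  rewrite last_rcons -rcons_cons -cats1 pairwise_cat => /and3P[/allrelP H _ _] ne yW Lt.
  rewrite mem_cat mem_seq1 (eq_sym top) (negbTE ne) orbF => ts.
  have ty := H _ _ ts (mem_head _ _).
  by have := lt_tr tW yW yW Lt ty; rewrite (negbTE (ltxx yW)).
- by apply: (@pairwise_cover_path [::]); rewrite cat0s -El // => z.
Qed.
End Chains.

(** * Gluing Hamiltonian paths of blocks, traversed in alternating directions *)

Section Zigzag.
Variables (I : eqType) (U : finType) (e : rel U).
Variables (F : I -> {set U}) (bot top : I -> U).
Hypothesis e_sym : symmetric e.

Definition traversable (W : {set U}) (x y : U) :=
  exists s, [/\ uniq (x :: s), (forall z, (z \in x :: s) = (z \in W)), last x s = y & path e x s].

Lemma traversable_sym W x y : traversable W x y -> traversable W y x.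
Proof.
case=> s [us ms ls ps]; exists (rev (belast x s)).
have revE : y :: rev (belast x s) = rev (x :: s) by rewrite [in RHS]lastI rev_rcons ls.
split; first by rewrite revE rev_uniq.
- by move=> z; rewrite revE mem_rev ms.
- by case: (s) ls => [|z s0] //= _; rewrite rev_cons last_rcons.
- by rewrite -ls rev_path (eq_path (e' := e)) // => u v; rewrite e_sym.
Qed.

(** The flag [o] records the end at which the first block is entered. It is negated from block to
    block, so consecutive blocks are linked alternately by an edge between tops and an edge between
    bottoms. *)
Lemma zigzag (l : seq I) (c : I) (o : bool) :
  uniq (c :: l) ->
  {in c :: l, forall i, traversable (F i) (bot i) (top i)} ->
  {in c :: l &, forall i j z, z \in F i -> z \in F j -> i = j} ->
  path (fun i j => e (bot i) (bot j) && e (top i) (top j)) c l ->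
  exists s, let x := if o then bot c else top c in
  [/\ uniq (x :: s), (forall z, (z \in x :: s) = has (fun i => z \in F i) (c :: l))
    & path e x s].
Proof.
elim: l c o => [|c' l IH] c o ucl Hs Hd pcl;
  have [s' [us' ms' ls' ps']] : traversable (F c) (if o then bot c else top c)
     (if o then top c else bot c)
    by case: (o); first (by apply: Hs; rewrite mem_head);
       apply/traversable_sym/Hs; rewrite mem_head.
- by exists s'; split => // z; rewrite ms' /= orbF.
- move: pcl => /= /andP[/andP[eb et] pl].
  have [|i ii|i j ii jj|//|s2 [u2 m2 p2]] := IH c' (~~ o).
  + by case/andP: ucl.
  + by apply: Hs; rewrite in_cons ii orbT.
  + by apply: Hd; rewrite in_cons ?ii ?jj orbT.
  set x := if o then bot c else top c in us' ms' ls' ps' *.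
  exists (s' ++ (if ~~ o then bot c' else top c') :: s2); cbv zeta; rewrite -/x -cat_cons; split.
  + rewrite -[_ && _]/(uniq ((x :: s') ++ _)) (cat_uniq (x :: s')) us' u2 andbT andTb.
    apply/hasPn => z; rewrite m2 => /hasP[j jl zj]; apply/negP; rewrite ms' => zc.
    have jj : j \in c :: c' :: l by rewrite in_cons jl orbT.
    have cj := Hd _ _ (mem_head _ _) jj _ zc zj.
    by move: ucl; rewrite cons_uniq cj jl.
  + by move=> z; rewrite mem_cat ms' m2.
  + by rewrite cat_path ps' ls' /= p2 andbT; case: (o).
Qed.
End Zigzag.

(** * The quotient of a finite lattice by a congruence, as a poset *)

Section Congruence.
Variables (T : finType) (V : {set T}) (le eqv : rel T).
Hypothesis latV : is_lattice V le.
Hypothesis congV : lattice_congruence V le eqv.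

Definition cls x : {set T} := [set y in V | eqv x y].

Let lexx x : x \in V -> le x x. Proof. by move=> xV; have [[H _ _] _] := latV; apply: H. Qed.
Let le_tr y x z : x \in V -> y \in V -> z \in V -> le x y -> le y z -> le x z.
Proof. by move=> xV yV zV; have [[_ _ H] _] := latV; apply: H. Qed.
Let exx x : x \in V -> eqv x x. Proof. by move=> xV; have [[H _ _] _] := congV; apply: H. Qed.
Let e_sym x y : x \in V -> y \in V -> eqv x y -> eqv y x.
Proof. by move=> xV yV; have [[_ H _] _] := congV; apply: H. Qed.
Let e_tr y x z : x \in V -> y \in V -> z \in V -> eqv x y -> eqv y z -> eqv x z.
Proof. by move=> xV yV zV; have [[_ _ H] _] := congV; apply: H. Qed.

Lemma congr_glb x x' y y' z z' : x \in V -> x' \in V -> y \in V -> y' \in V ->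
  eqv x x' -> eqv y y' -> is_glb V le x y z -> is_glb V le x' y' z' -> eqv z z'.
Proof.
move=> xV xV' yV yV' e1 e2; have [_ H] := congV.
by have [G _] := H _ _ _ _ xV xV' yV yV' e1 e2; apply: G.
Qed.

Lemma congr_lub x x' y y' z z' : x \in V -> x' \in V -> y \in V -> y' \in V ->
  eqv x x' -> eqv y y' -> is_lub V le x y z -> is_lub V le x' y' z' -> eqv z z'.
Proof.
move=> xV xV' yV yV' e1 e2; have [_ H] := congV.
by have [_ G] := H _ _ _ _ xV xV' yV yV' e1 e2; apply: G.
Qed.

Lemma lub_le x y : x \in V -> y \in V -> le x y -> is_lub V le x y y.
Proof. by move=> xV yV xy; split; auto. Qed.

Lemma glb_le x y : x \in V -> y \in V -> le x y -> is_glb V le x y x.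
Proof. by move=> xV yV xy; split; auto. Qed.

Lemma clsP X : reflect (exists2 x, x \in V & X = cls x) (X \in classes V eqv).
Proof. exact: imsetP. Qed.

Lemma cls_in x : x \in V -> cls x \in classes V eqv.
Proof. by move=> xV; apply/clsP; exists x. Qed.

Lemma mem_cls x y : (y \in cls x) = (y \in V) && eqv x y.
Proof. by rewrite inE. Qed.

Lemma cls_eq x y : x \in V -> y \in V -> (cls x = cls y) <-> eqv x y.
Proof.
move=> xV yV; split=> [E|xy].
  by have: y \in cls x by [rewrite E mem_cls yV exx]; rewrite mem_cls yV.
apply/setP => z; rewrite !mem_cls; case zV: (z \in V) => //=.
by apply/idP/idP; apply: e_tr => //; apply: e_sym.
Qed.

Lemma qle_clsP x y : x \in V -> y \in V ->
  reflect (exists x' y', [/\ x' \in V, y' \in V & [/\ eqv x x', eqv y y' & le x' y']])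
          (qle le (cls x) (cls y)).
Proof.
move=> xV yV; apply: (iffP existsP) => [[x' /andP[]]|[x' [y' [xV' yV' [e1 e2 l]]]]].
  rewrite mem_cls => /andP[xV' e1] /existsP[y' /andP[]].
  by rewrite mem_cls => /andP[yV' e2] l; exists x', y'.
by exists x'; rewrite mem_cls xV' e1; apply/existsP; exists y'; rewrite mem_cls yV' e2.
Qed.

Lemma qle_cls x y : x \in V -> y \in V -> le x y -> qle le (cls x) (cls y).
Proof. by move=> xV yV xy; apply/qle_clsP => //; exists x, y; rewrite !exx. Qed.

(** From [x1 <= y1] and [y2 <= x2] with [x1 ~ x2] and [y1 ~ y2], the meets of the pairs [x1, y1] and
    [x2, y2] are [x1] and [y2], so these are congruent. *)
Lemma qle_anti : {in classes V eqv &, forall X Y, qle le X Y -> qle le Y X -> X = Y}.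
Proof.
move=> _ _ /clsP[x xV ->] /clsP[y yV ->].
case/qle_clsP => // x1 [y1 [x1V y1V [ex1 ey1 l1]]].
case/qle_clsP => // y2 [x2 [y2V x2V [ey2 ex2 l2]]].
apply/cls_eq => //.
have e1 : eqv x1 x2 by apply: e_tr ex2 => //; apply: e_sym.
have e2 : eqv y1 y2 by apply: e_tr ey2 => //; apply: e_sym.
have := congr_glb x1V x2V y1V y2V e1 e2 (glb_le x1V y1V l1).
have G : is_glb V le x2 y2 y2 by split; auto.
move=> /(_ _ G) e3.
by apply: (e_tr (y := x1)) => //; apply: (e_tr (y := y2)) => //; apply: e_sym.
Qed.

(** Given [x1 <= y1], [y2 <= z2] and [y1 ~ y2], the join of [y1] and [z2] lies above [x1] and is
    congruent to the join of [y2] and [z2], which is [z2]. *)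
Lemma qle_trans : {in classes V eqv & &, forall Y X Z, qle le X Y -> qle le Y Z -> qle le X Z}.
Proof.
move=> _ _ _ /clsP[y yV ->] /clsP[x xV ->] /clsP[z zV ->].
case/qle_clsP => // x1 [y1 [x1V y1V [ex1 ey1 l1]]].
case/qle_clsP => // y2 [z2 [y2V z2V [ey2 ez2 l2]]].
have [_ /(_ _ _ y1V z2V)[[w wP] _]] := latV.
have [wV y1w z2w _] := wP.
have e2 : eqv y1 y2 by apply: e_tr ey2 => //; apply: e_sym.
have e3 := congr_lub y1V y2V z2V z2V e2 (exx z2V) wP (lub_le y2V z2V l2).
apply/qle_clsP => //; exists x1, w; split => //; split => //.
  by apply: (e_tr (y := z2)) => //; apply: e_sym.
exact: le_tr y1w.
Qed.

Lemma qlt_irr X : ~~ qlt le X X.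
Proof. by rewrite /qlt eqxx. Qed.

Lemma qlt_trans : {in classes V eqv & &, forall Y X Z, qlt le X Y -> qlt le Y Z -> qlt le X Z}.
Proof.
move=> Y X Z YV XV ZV /andP[nXY XY] /andP[nYZ YZ]; apply/andP; split; last exact: qle_trans YZ.
by apply: contra nXY => /eqP XZ; rewrite -XZ in YZ; apply/eqP/qle_anti.
Qed.

Lemma qcoverP X Y : X \in classes V eqv -> Y \in classes V eqv ->
  X <> Y -> qle le X Y ->
  (forall Z, Z \in classes V eqv -> qle le X Z -> qle le Z Y -> Z = X \/ Z = Y) ->
  qcover V le eqv X Y.
Proof.
move=> XV YV nXY XY H; apply/and4P; split => //; first by apply/andP; split => //; apply/eqP.
apply/existsP => -[Z /and3P[ZV /andP[/eqP n1 l1] /andP[/eqP n2 l2]]].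
by case: (H Z ZV l1 l2) => E; [case: n1|case: n2].
Qed.

Lemma qcover_between X Y Z : qcover V le eqv X Y ->
  Z \in classes V eqv -> qle le X Z -> qle le Z Y -> Z = X \/ Z = Y.
Proof.
case/and4P => _ _ _ /existsP H ZV XZ ZY.
case: (eqVneq X Z) => [->|n1]; first by left.
case: (eqVneq Z Y) => [->|n2]; first by right.
by case: H; exists Z; rewrite /qlt ZV n1 n2 XZ ZY.
Qed.

End Congruence.

(** * Lifting Hamiltonian paths along a lattice map whose fibres are chains *)

Section FibredLattice.
Variables (T T0 : finType) (V : {set T}) (le : rel T) (V0 : {set T0}) (le0 : rel T0).
Variables (rho : T -> T0) (bot top : T0 -> T).
Hypotheses (latV : is_lattice V le) (latV0 : is_lattice V0 le0).
Hypotheses (rhoV : {in V, forall x, rho x \in V0}).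
Hypotheses (botV : {in V0, forall Q, bot Q \in V}) (topV : {in V0, forall Q, top Q \in V}).
Hypotheses (rho_bot : {in V0, forall Q, rho (bot Q) = Q}).
Hypotheses (rho_top : {in V0, forall Q, rho (top Q) = Q}).
Hypothesis rho_mono : {in V &, forall x y, le x y -> le0 (rho x) (rho y)}.
Hypothesis bot_mono : {in V0 &, forall P Q, le0 P Q -> le (bot P) (bot Q)}.
Hypothesis top_mono : {in V0 &, forall P Q, le0 P Q -> le (top P) (top Q)}.
Hypothesis bot_le : {in V, forall x, le (bot (rho x)) x}.
Hypothesis le_top : {in V, forall x, le x (top (rho x))}.
Hypothesis bot_down : {in V & V0, forall x Q, le x (bot Q) -> x = bot (rho x)}.
Hypothesis top_up : {in V & V0, forall x Q, le (top Q) x -> x = top (rho x)}.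
Hypothesis fibre_total : {in V &, forall x y, rho x = rho y -> le x y || le y x}.

Variable eqv : rel T.
Hypothesis congV : lattice_congruence V le eqv.

Let lexx x : x \in V -> le x x. Proof. by move=> xV; have [[H _ _] _] := latV; apply: H. Qed.
Let le_tr y x z : x \in V -> y \in V -> z \in V -> le x y -> le y z -> le x z.
Proof. by move=> xV yV zV; have [[_ _ H] _] := latV; apply: H. Qed.
Let le0_anti x y : x \in V0 -> y \in V0 -> le0 x y -> le0 y x -> x = y.
Proof. by move=> xV yV; have [[_ H _] _] := latV0; apply: H. Qed.
Let exx x : x \in V -> eqv x x. Proof. by move=> xV; have [[H _ _] _] := congV; apply: H. Qed.
Let e_sym x y : x \in V -> y \in V -> eqv x y -> eqv y x.
Proof. by move=> xV yV; have [[_ H _] _] := congV; apply: H. Qed.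
Let e_tr y x z : x \in V -> y \in V -> z \in V -> eqv x y -> eqv y z -> eqv x z.
Proof. by move=> xV yV zV; have [[_ _ H] _] := congV; apply: H. Qed.

Definition base_congr : rel T0 := fun P Q => eqv (bot P) (bot Q).
Let e0 := base_congr.
Let cl := cls V eqv.
Let cl0 := cls V0 e0.

(** Bottoms form a down-set by [bot_down], so every common lower bound is itself a bottom and can be
    compared in the base. *)
Lemma glb_bot x Q : x \in V -> Q \in V0 -> le0 (rho x) Q -> is_glb V le x (bot Q) (bot (rho x)).
Proof.
move=> xV QV xQ; have rV := rhoV xV; split; auto.
by move=> w wV wx wb; rewrite (bot_down wV QV wb); apply: bot_mono; auto.
Qed.

Lemma lub_top x Q : x \in V -> Q \in V0 -> le0 Q (rho x) -> is_lub V le x (top Q) (top (rho x)).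
Proof.
move=> xV QV xQ; have rV := rhoV xV; split; auto.
by move=> w wV wx wb; rewrite (top_up wV QV wb); apply: top_mono; auto.
Qed.

(** Meeting both elements with the bottom over a common upper bound of [rho x] and [rho y] sends
    each to the bottom of its own fibre. *)
Lemma eqv_rho x y : x \in V -> y \in V -> eqv x y -> e0 (rho x) (rho y).
Proof.
move=> xV yV xy.
have [_ /(_ _ _ (rhoV xV) (rhoV yV))[[W [WV xW yW _]] _]] := latV0.
have bV := botV WV.
exact: (congr_glb congV xV yV bV bV xy (exx bV) (glb_bot xV WV xW) (glb_bot yV WV yW)).
Qed.

(** Dually, joining the two bottoms with the top over a common lower bound of [P] and [Q] sends each
    to the top of its own fibre. *)
Lemma base_eqv_top P Q : P \in V0 -> Q \in V0 -> e0 P Q -> eqv (top P) (top Q).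
Proof.
move=> PV QV PQ.
have [_ /(_ _ _ PV QV)[_ [W [WV WP WQ _]]]] := latV0.
have tV := topV WV.
have bP := botV PV; have bQ := botV QV.
have LP := @lub_top _ _ bP WV; have LQ := @lub_top _ _ bQ WV.
rewrite !rho_bot // in LP LQ.
exact: (congr_lub congV bP bQ tV tV PQ (exx tV) (LP WP) (LQ WQ)).
Qed.

(** The map [bot] preserves meets ([bg]) and joins ([bl]), so it embeds the base as a sublattice, to
    which the congruence restricts. *)
Lemma base_congrP : lattice_congruence V0 le0 base_congr.
Proof.
split.
  split=> [x xV|x y xV yV|x y z xV yV zV]; rewrite /base_congr; auto.
  by apply: e_tr; auto.
have bg P Q z : P \in V0 -> Q \in V0 -> is_glb V0 le0 P Q z ->
    is_glb V le (bot P) (bot Q) (bot z).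
  move=> PV QV [zV zP zQ H]; split; auto.
  move=> w wV wP wQ; rewrite (bot_down wV PV wP); apply: bot_mono; auto.
  by apply: H; auto; [rewrite -(rho_bot PV)|rewrite -(rho_bot QV)]; apply: rho_mono; auto.
have bl P Q z : P \in V0 -> Q \in V0 -> is_lub V0 le0 P Q z ->
    is_lub V le (bot P) (bot Q) (bot z).
  move=> PV QV [zV zP zQ H]; split; auto.
  move=> w wV wP wQ; apply: (le_tr (y := bot (rho w))); auto; apply: bot_mono; auto.
  by apply: H; auto; [rewrite -(rho_bot PV)|rewrite -(rho_bot QV)]; apply: rho_mono; auto.
move=> x x' y y' xV xV' yV yV' ex ey; split=> z z' zP zP'.
  by apply: (congr_glb congV _ _ _ _ ex ey (bg _ _ _ xV yV zP) (bg _ _ _ xV' yV' zP')); auto.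
by apply: (congr_lub congV _ _ _ _ ex ey (bl _ _ _ xV yV zP) (bl _ _ _ xV' yV' zP')); auto.
Qed.

Let congV0 := base_congrP.
Let e0_sym x y : x \in V0 -> y \in V0 -> e0 x y -> e0 y x.
Proof. by move=> xV yV; have [[_ H _] _] := congV0; apply: H. Qed.
Let e0_tr y x z : x \in V0 -> y \in V0 -> z \in V0 -> e0 x y -> e0 y z -> e0 x z.
Proof. by move=> xV yV zV; have [[_ _ H] _] := congV0; apply: H. Qed.

(* The representative is [(x \/ bot Q) /\ top Q]. *)
Lemma fibre_repr x Q : x \in V -> Q \in V0 -> e0 (rho x) Q ->
  exists2 y, y \in V & rho y = Q /\ eqv x y.
Proof.
move=> xV QV xQ; have rV := rhoV xV; have bV := botV QV; have tV := topV QV.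
have [_ L] := latV.
have [[y yP] _] := L _ _ xV bV.
have [yV xy by' _] := yP.
have bx : is_lub V le x (bot (rho x)) x by split; auto.
have exy : eqv x y by apply: (congr_lub congV xV xV _ bV (exx xV) xQ bx yP); auto.
have [_ [z zP]] := L _ _ yV tV.
have [zV zy zt zH] := zP.
have yQ : e0 (rho y) Q.
  by apply: (e0_tr (y := rho x)); auto; apply: eqv_rho => //; apply: e_sym.
have ry := rhoV yV; have tt := topV ry.
have yg : is_glb V le y (top (rho y)) y by split; auto.
have eyz : eqv y z.
  by apply: (congr_glb congV yV yV tt tV (exx yV) _ yg zP); apply: base_eqv_top.
exists z => //; split; last exact: (e_tr (y := y)).
apply: le0_anti; auto.
  by rewrite -[X in le0 _ X](rho_top QV); apply: rho_mono.
rewrite -[X in le0 X _](rho_bot QV); apply: rho_mono => //; apply: zH => //.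
by rewrite -[X in top X](rho_bot QV) le_top.
Qed.

Lemma qle_rho x y : x \in V -> y \in V ->
  qle le (cl x) (cl y) -> qle le0 (cl0 (rho x)) (cl0 (rho y)).
Proof.
move=> xV yV /(qle_clsP le eqv xV yV)[x' [y' [xV' yV' [ex ey l]]]].
apply/qle_clsP; auto; exists (rho x'), (rho y'); split; auto; split.
- exact: eqv_rho.
- exact: eqv_rho.
- exact: rho_mono.
Qed.

Let cl_eq x y : x \in V -> y \in V -> cl x = cl y <-> eqv x y.
Proof. exact: (cls_eq congV). Qed.
Let cl0_eq x y : x \in V0 -> y \in V0 -> cl0 x = cl0 y <-> e0 x y.
Proof. exact: (cls_eq congV0). Qed.

(** A class below that of [bot Q] contains a bottom: meet a suitable representative with [bot Q] and
    use that bottoms form a down-set. A class in between is thus determined by its projection, and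
    the cover in the base leaves only the two ends. *)
Lemma qcover_bot P Q : P \in V0 -> Q \in V0 ->
  qcover V0 le0 e0 (cl0 P) (cl0 Q) -> qcover V le eqv (cl (bot P)) (cl (bot Q)).
Proof.
move=> PV QV c; have bP := botV PV; have bQ := botV QV.
have [_ _ /andP[/eqP n l] _] := and4P c.
case/(qle_clsP le0 e0 PV QV): l => P' [Q' [PV' QV' [eP eQ l]]].
apply: qcoverP; rewrite ?cls_in //.
- by move=> /cl_eq E; apply: n; apply/cl0_eq => //; apply: E.
- by apply/qle_clsP => //; exists (bot P'), (bot Q'); split; auto; split => //; apply: bot_mono.
- move=> _ /clsP[z zV ->] l1 l2.
  have rV := rhoV zV.
  have := qle_rho bP zV l1; have := qle_rho zV bQ l2; rewrite !rho_bot // => l3 l4.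
  have zb : cl z = cl (bot (rho z)).
    case/(qle_clsP le eqv zV bQ): l2 => z' [q [zV' qV [ez eq zq]]].
    have [_ /(_ _ _ zV' bQ)[_ [w wP]]] := latV.
    have [wV _ wq _] := wP.
    have ew : eqv z' w.
      by apply: (congr_glb congV zV' zV' qV bQ (exx zV') (e_sym bQ qV eq) (glb_le latV zV' qV zq) wP).
    have zw : eqv z w by apply: (e_tr (y := z')).
    apply/cl_eq; auto; apply: (e_tr (y := w)); auto.
    by rewrite (bot_down wV QV wq); apply: e_sym; auto; apply: eqv_rho.
  case: (qcover_between c (cls_in e0 rV) l4 l3) => /cl0_eq E; [left|right];
    by rewrite -/cl zb; apply/cl_eq; auto; apply: E.
Qed.

(** The dual argument: joining with [top P] shows that a class above that of [top P] contains a top,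
    since tops form an up-set. *)
Lemma qcover_top P Q : P \in V0 -> Q \in V0 ->
  qcover V0 le0 e0 (cl0 P) (cl0 Q) -> qcover V le eqv (cl (top P)) (cl (top Q)).
Proof.
move=> PV QV c; have tP := topV PV; have tQ := topV QV.
have [_ _ /andP[/eqP n l] _] := and4P c.
case/(qle_clsP le0 e0 PV QV): l => P' [Q' [PV' QV' [eP eQ l]]].
apply: qcoverP; rewrite ?cls_in //.
- move=> /cl_eq E; apply: n; apply/cl0_eq => //.
  by rewrite -(rho_top PV) -(rho_top QV); apply: eqv_rho; auto.
- by apply/qle_clsP => //; exists (top P'), (top Q'); split; auto; split;
  [exact: base_eqv_top | exact: base_eqv_top | exact: top_mono].
- move=> _ /clsP[z zV ->] l1 l2.
  have rV := rhoV zV.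
  have := qle_rho tP zV l1; have := qle_rho zV tQ l2; rewrite !rho_top // => l3 l4.
  have zb : cl z = cl (top (rho z)).
    case/(qle_clsP le eqv tP zV): l1 => q [z' [qV zV' [eq ez zq]]].
    have [_ /(_ _ _ tP zV')[[w wP] _]] := latV.
    have [wV wq _ _] := wP.
    have ew : eqv z' w.
      by apply: (congr_lub congV qV tP zV' zV' (e_sym tP qV eq) (exx zV') (lub_le latV qV zV' zq) wP).
    have zw : eqv z w by apply: (e_tr (y := z')).
    apply/cl_eq; auto; apply: (e_tr (y := w)); auto.
    by rewrite (top_up wV PV wq); apply: e_sym; auto; apply: base_eqv_top; auto; apply: eqv_rho.
  case: (qcover_between c (cls_in e0 rV) l4 l3) => /cl0_eq E; [left|right];
    by rewrite -/cl zb; apply/cl_eq; auto; apply: base_eqv_top; auto.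
Qed.

Definition fibre_classes (C : {set T0}) : {set {set T}} :=
  [set X in classes V eqv | [exists x in X, rho x \in C]].

Lemma mem_fibre_classes x Q : x \in V -> Q \in V0 ->
  (cl x \in fibre_classes (cl0 Q)) = e0 Q (rho x).
Proof.
move=> xV QV; rewrite inE cls_in //=; apply/existsP/idP => [[y /andP[]]|E].
  rewrite !mem_cls => /andP[yV xy] /andP[rV Qy].
  by apply: (e0_tr (y := rho y)); auto; apply: eqv_rho => //; apply: e_sym.
by exists x; rewrite !mem_cls xV exx // rhoV.
Qed.

(** All classes over the base class of [Q] are represented in the single fibre over [Q], and so
    inherit the total order of that fibre. *)
Lemma fibre_class_repr X Q : Q \in V0 -> X \in fibre_classes (cl0 Q) ->
  exists2 x, x \in V & rho x = Q /\ X = cl x.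
Proof.
move=> QV XF; have /setIdP[/clsP[x xV Xx] _] := XF.
move: XF; rewrite Xx mem_fibre_classes // => E.
have [y yV [ry xy]] := fibre_repr xV QV (e0_sym QV (rhoV xV) E).
by exists y => //; split => //; apply/cl_eq.
Qed.

Let adjq X Y := qcover V le eqv X Y || qcover V le eqv Y X.

Lemma fibre_traversable Q : Q \in V0 ->
  traversable adjq (fibre_classes (cl0 Q)) (cl (bot Q)) (cl (top Q)).
Proof.
move=> QV; set W := fibre_classes _.
have bQ := botV QV; have tQ := topV QV.
have WV X : X \in W -> X \in classes V eqv by case/setIdP.
have e0Q : e0 Q Q by apply: exx.
have [|||||||s [us ms ls ps]] := @chain_cover_path _ W (qlt le) _ _ _ (cl (bot Q)) (cl (top Q)).
- by move=> X _; apply: qlt_irr.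
- by move=> Y X Z /WV YV /WV XV /WV ZV; apply: (qlt_trans latV congV).
- move=> X Y XW YW ne.
  have [x xV [rx Xx]] := fibre_class_repr QV XW.
  have [y yV [ry Yy]] := fibre_class_repr QV YW.
  rewrite /qlt (eq_sym Y) ne /= Xx Yy.
  have /orP[l|l] : le x y || le y x by apply: fibre_total => //; rewrite rx.
    by rewrite (qle_cls congV xV yV l).
  by rewrite (qle_cls congV yV xV l) orbT.
- by rewrite mem_fibre_classes // rho_bot.
- by rewrite mem_fibre_classes // rho_top.
- move=> X XW ne; have [x xV [rx Xx]] := fibre_class_repr QV XW.
  rewrite /qlt eq_sym ne Xx /=; apply: (qle_cls congV) => //.
  by rewrite -rx; apply: bot_le.
- move=> X XW ne; have [x xV [rx Xx]] := fibre_class_repr QV XW.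
  rewrite /qlt ne Xx /=; apply: (qle_cls congV) => //.
  by rewrite -rx; apply: le_top.
exists s; split => //.
have sW : all (mem W) (cl (bot Q) :: s) by apply/allP => z; rewrite ms.
apply: (sub_in_path (P := mem W)) sW ps => X Y XW YW /andP[XY /existsP nb].
rewrite /adjq; apply/orP; left; apply/and4P; split; rewrite ?WV //.
(* The projection of a class between [X] and [Y] is squeezed between two copies of the base class of
   [Q], so the class lies in [W]: a cover inside [W] is a cover of the whole quotient. *)
apply/existsP => -[Z /and3P[ZV XZ ZY]]; apply: nb; exists Z; rewrite XZ ZY !andbT.
case/clsP: ZV XZ ZY => z zV -> /andP[_ XZ] /andP[_ ZY].
have [x xV [rx Xx]] := fibre_class_repr QV XW.
have [y yV [ry Yy]] := fibre_class_repr QV YW.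
rewrite Xx in XZ; rewrite Yy in ZY.
have := qle_rho xV zV XZ; have := qle_rho zV yV ZY; rewrite rx ry => l1 l2.
rewrite mem_fibre_classes //; apply/cl0_eq; auto.
by apply: (qle_anti latV0 congV0); rewrite ?cls_in; auto.
Qed.

Lemma fibred_hamiltonian :
  (forall eqv0, lattice_congruence V0 le0 eqv0 ->
     hamiltonian_path (classes V0 eqv0) (qcover V0 le0 eqv0)) ->
  hamiltonian_path (classes V eqv) (qcover V le eqv).
Proof.
move=> /(_ _ congV0)[C [l [ul ml pl]]].
(* The zigzag needs ends indexed by base classes rather than by representatives; [B f C] collects
   the classes of all [f Q] with [Q] in [C], which coincide when [f] is [bot] or [top]. *)
pose B (f : T0 -> T) (C : {set T0}) : {set T} := [set y in V | [exists Q in C, eqv (f Q) y]].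
have BE f Q : (forall P, P \in V0 -> f P \in V) ->
    (forall P, P \in V0 -> e0 P Q -> eqv (f P) (f Q)) -> Q \in V0 -> B f (cl0 Q) = cl (f Q).
  move=> fV fE QV; apply/setP => y; rewrite !inE; case yV: (y \in V) => //=.
  apply/existsP/idP => [[P /andP[]]|E].
    rewrite mem_cls => /andP[PV QP] E; apply: (e_tr (y := f P)) => //; auto.
  by exists Q; rewrite mem_cls QV E andbT; apply: exx; auto.
have BbE Q : Q \in V0 -> B bot (cl0 Q) = cl (bot Q) by move=> QV; apply: BE.
have BtE Q : Q \in V0 -> B top (cl0 Q) = cl (top Q).
  by move=> QV; apply: BE => // P PV; apply: base_eqv_top.
have clV D : D \in C :: l -> exists2 Q, Q \in V0 & D = cl0 Q by rewrite ml => /clsP.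
have adj_sym : symmetric adjq by move=> X Y; rewrite /adjq orbC.
have [|||s [us ms ps]] := @zigzag _ _ adjq fibre_classes (B bot) (B top) adj_sym l C true ul.
- by move=> D /clV[Q QV ->]; rewrite BbE // BtE //; apply: fibre_traversable.
- move=> D D' /clV[Q QV ->] /clV[Q' QV' ->] X XF.
  have [x xV [rx Xx]] := fibre_class_repr QV XF.
  by rewrite Xx mem_fibre_classes // => E; apply/esym/cl0_eq; rewrite -?rx; auto.
- have inC : all (mem (C :: l)) (C :: l) by apply/allP.
  apply: (sub_in_path (P := mem (C :: l))) inC pl => _ _ /clV[P PV ->] /clV[Q QV ->].
  rewrite !BbE // !BtE // /adjq => /orP[c|c].
    by rewrite qcover_bot // qcover_top.
  by rewrite [X in _ || X]qcover_bot // [X in _ && (_ || X)]qcover_top // !orbT.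
exists (B bot C), s; split => // X; rewrite ms.
apply/hasP/idP => [[D _]|/clsP[x xV ->]]; first by case/setIdP.
exists (cl0 (rho x)); first by rewrite ml cls_in // rhoV.
by rewrite mem_fibre_classes ?rhoV //; apply: exx; auto.
Qed.

End FibredLattice.

Import Order.TTheory GRing.Theory Num.Theory.
Local Open Scope ring_scope.

(** * The scalar product, small perturbations and generic points *)

Section Dotv.
Variables (R : realType) (d : nat).
Implicit Types (u v x y : 'rV[R]_d) (c : R).

Lemma dotvC u x : dotv u x = dotv x u.
Proof. by apply: eq_bigr => k _; rewrite mulrC. Qed.

Lemma dotvDZr u x c y : dotv u (x + c *: y) = dotv u x + c * dotv u y.
Proof.
rewrite /dotv mulr_sumr -big_split; apply: eq_bigr => k _ /=.
by rewrite !mxE mulrDr mulrCA.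
Qed.

Lemma dotvDZl u v c x : dotv (u + c *: v) x = dotv u x + c * dotv v x.
Proof. by rewrite dotvC dotvDZr !(dotvC x). Qed.

Lemma dotv0 u : dotv u 0 = 0.
Proof. by rewrite /dotv big1 // => k _; rewrite mxE mulr0. Qed.

Lemma dotvZr u c x : dotv u (c *: x) = c * dotv u x.
Proof. by rewrite -[c *: x]add0r dotvDZr dotv0 add0r. Qed.

Lemma dotvZl u c x : dotv (c *: u) x = c * dotv u x.
Proof. by rewrite dotvC dotvZr dotvC. Qed.

Lemma dotvv_eq0 u : (dotv u u == 0) = (u == 0).
Proof.
apply/eqP/eqP => [H|->]; last exact: dotv0.
apply/rowP => k; rewrite mxE; apply/eqP; rewrite -sqrf_eq0 expr2; apply/eqP.
by apply: (psumr_eq0P (P := predT) _ H) => // i _; rewrite -expr2 sqr_ge0.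
Qed.

Lemma small_perturbation (bs : seq 'rV[R]_d) x w :
  {in bs, forall b, dotv b x != 0} ->
  exists2 e, 0 < e & forall e', 0 < e' <= e -> {in bs, forall b,
    dotv b (x + e' *: w) != 0 /\ (0 < dotv b (x + e' *: w)) = (0 < dotv b x)}.
Proof.
elim: bs => [|b bs IH] H; first by exists 1.
have [c cb|e e0 He] := IH; first by apply: H; rewrite in_cons cb orbT.
have bx := H b (mem_head _ _).
(* Adding 1 keeps the denominator positive and makes the change of the value at [b] strictly smaller
   than that value. *)
pose e1 := `|dotv b x| / (`|dotv b w| + 1).
have w1 : 0 < `|dotv b w| + 1 by rewrite ltr_wpDl.
have e10 : 0 < e1 by rewrite divr_gt0 // normr_gt0.
exists (Num.min e e1); first by rewrite lt_min e0.
move=> e' /andP[e'0]; rewrite le_min => /andP[e'e e'e1] c.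
rewrite in_cons => /orP[/eqP->|cb]; last by apply: He => //; rewrite e'0.
rewrite dotvDZr.
have small : `|e' * dotv b w| < `|dotv b x|.
  rewrite normrM gtr0_norm //; apply: le_lt_trans (_ : e1 * `|dotv b w| < _).
    by rewrite ler_wpM2r.
  by rewrite /e1 mulrAC ltr_pdivrMr // ltr_pM2l ?normr_gt0 // ltrDl.
move: small; rewrite ltr_norml => /andP[].
case: (ltrgt0P (dotv b x)) bx => // bx _; lra.
Qed.

(** The vectors of [cs] are treated one at a time: if [c] vanishes at the current point, a small
    move along [c] itself repairs this, as [dotv c c] is nonzero, and preserves the signs and
    inequalities already obtained. *)
Lemma generic_point (bs cs : seq 'rV[R]_d) x :
  {in bs, forall b, dotv b x != 0} -> {in cs, forall w, w != 0} ->
  exists y, {in bs, forall b, dotv b y != 0 /\ (0 < dotv b y) = (0 < dotv b x)} /\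
            {in cs, forall w, dotv w y != 0}.
Proof.
elim: cs => [|c cs IH] Hb Hc; first by exists x; split => // b /Hb.
have [//|c' c'c|y [yb yc]] := IH; first by apply: Hc; rewrite in_cons c'c orbT.
have [cy|cy] := eqVneq (dotv c y) 0; last first.
  by exists y; split => // c'; rewrite in_cons => /orP[/eqP->|/yc].
have [b|e e0 He] := @small_perturbation (bs ++ cs) y c.
  by rewrite mem_cat => /orP[/yb[]|/yc].
have {}He := He e; rewrite e0 lexx in He; have {}He := He isT.
exists (y + e *: c); split => [b bb|c'].
  have [|n s] := He b; first by rewrite mem_cat bb.
  by split => //; rewrite s; case: (yb b bb).
rewrite in_cons => /orP[/eqP->|cc]; last by case: (He c'); rewrite ?mem_cat ?cc ?orbT.
by rewrite dotvDZr cy add0r mulf_neq0 ?(gt_eqF e0) // dotvv_eq0 Hc // mem_head.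
Qed.

End Dotv.

(** * Linear algebra of normals, and regions as sign vectors of points *)

Section Arrangement.
Variables (R : realType) (d m : nat) (a : 'I_m -> 'rV[R]_d).
Hypothesis arr : arrangement a.
Implicit Types (S : {set 'I_m}) (s t B : {ffun 'I_m -> bool}) (x y v : 'rV[R]_d).

Let ax i x := dotv (a i) x.

Lemma normals_indep i j c e : i != j -> (forall x, c * ax i x + e * ax j x = 0) -> c = 0 /\ e = 0.
Proof.
wlog : i j c e / exists x, ax i x = 0 /\ ax j x != 0 => [W ij H|[x [xi xj]] ij H].
  have [nz /(_ i j ij)[x]] := arr; rewrite -!/(ax _ _).
  case: (eqVneq (ax i x) 0) => [xi|xi]; case: (eqVneq (ax j x) 0) => [xj|xj] // _.
    by apply: (W i j) => //; exists x.
  have [|||-> ->] // := W j i e c; first by exists x.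
    by rewrite eq_sym.
  by move=> y; rewrite addrC.
have := H x; rewrite xi mulr0 add0r => /eqP; rewrite mulf_eq0 (negbTE xj) orbF => /eqP e0.
split => //; have := H (a i); rewrite e0 mul0r addr0 => /eqP.
by rewrite mulf_eq0 dotvv_eq0 (negbTE (arr.1 i)) orbF => /eqP.
Qed.

Lemma normals_dual i j : i != j -> exists u, ax i u != 0 /\ ax j u = 0.
Proof.
(* Up to a positive factor, [u] is the component of [a i] orthogonal to [a j]. *)
move=> ij; pose u := dotv (a j) (a j) *: a i + (- dotv (a i) (a j)) *: a j.
have uE x : dotv u x = dotv (a j) (a j) * ax i x + (- dotv (a i) (a j)) * ax j x.
  by rewrite dotvDZl dotvZl.
have ju : ax j u = 0 by rewrite /ax dotvC uE /ax (dotvC (a i)) mulNr mulrC subrr.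
exists u; split => //; apply/eqP => iu.
have: dotv u u == 0 by rewrite uE ju iu !mulr0 addr0.
rewrite dotvv_eq0 => /eqP u0.
have [|/eqP] := @normals_indep i j (dotv (a j) (a j)) (- dotv (a i) (a j)) ij.
  by move=> x; rewrite -uE u0 dotvC dotv0.
by rewrite dotvv_eq0 (negbTE (arr.1 j)).
Qed.

Definition kernel_incl i j k := forall x, ax i x = 0 -> ax j x = 0 -> ax k x = 0.

(** Subtracting multiples of dual vectors moves any [x] into the intersection of the hyperplanes [i]
    and [j], where [a k] vanishes; this gives the coefficients. Neither is zero, as distinct normals
    are not proportional. *)
Lemma kernel_span i j k : i != j -> k != i -> k != j -> kernel_incl i j k ->
  exists c e, [/\ c != 0, e != 0 & forall x, ax k x = c * ax i x + e * ax j x].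
Proof.
move=> ij ki kj H.
have [u [iu ju]] := normals_dual ij.
have [w [jw iw]] : exists u, ax j u != 0 /\ ax i u = 0 by apply: normals_dual; rewrite eq_sym.
have E x : ax k x = (ax k u / ax i u) * ax i x + (ax k w / ax j w) * ax j x.
  have := H (x + (- (ax i x / ax i u)) *: u + (- (ax j x / ax j w)) *: w).
  rewrite /ax !dotvDZr -!/(ax _ _) iw ju !mulr0 !addr0 !mulNr !divfK // !subrr.
  move=> /(_ erefl erefl) /eqP; rewrite -addrA -opprD subr_eq0 => /eqP->.
  by field; rewrite iu jw.
exists (ax k u / ax i u), (ax k w / ax j w); split => //; apply/eqP => c0.
  have [] := @normals_indep k j 1 (- (ax k w / ax j w)) kj.
    by move=> x; rewrite E c0 mul0r add0r mul1r mulNr subrr.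
  by move/eqP; rewrite oner_eq0.
have [] := @normals_indep k i 1 (- (ax k u / ax i u)) ki.
  by move=> x; rewrite E c0 mul0r addr0 mul1r mulNr subrr.
by move/eqP; rewrite oner_eq0.
Qed.

Definition avoids S x := forall i, i \in S -> ax i x != 0.
Definition sgnv S x : {ffun 'I_m -> bool} := [ffun i => (i \in S) && (0 < ax i x)].

Lemma regionP S s : reflect (exists2 x, avoids S x & s = sgnv S x) (s \in regions a S).
Proof.
rewrite inE; apply: (iffP (asboolP _)) => [[s0 [x xs]]|[x xS ->]].
  exists x => [i iS|]; first by case: (xs i iS).
  by apply/ffunP => i; rewrite ffunE; case: (boolP (i \in S)) => [/xs[_ <-]|/s0].
split=> [i /negbTE iS|]; first by rewrite ffunE iS.
by exists x => i iS; rewrite ffunE iS; split => //; apply: xS.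
Qed.

Lemma restr_sgnv S0 S x : S0 \subset S -> restr S0 (sgnv S x) = sgnv S0 x.
Proof.
move=> /subsetP sub; apply/ffunP => i; rewrite !ffunE.
by case: (boolP (i \in S0)) => //= /sub ->.
Qed.

Lemma avoidsS S0 S x : S0 \subset S -> avoids S x -> avoids S0 x.
Proof. by move=> /subsetP sub H i /sub /H. Qed.

Lemma perturb_avoids S x w : avoids S x ->
  exists2 e, 0 < e & forall i, i \in S ->
    ax i (x + e *: w) != 0 /\ (0 < ax i (x + e *: w)) = (0 < ax i x).
Proof.
move=> xS; have [b|e e0 He] := @small_perturbation _ _ [seq a i | i <- enum S] x w.
  by case/mapP => i; rewrite mem_enum => /xS xi ->.
exists e => // i iS; apply: He; first by rewrite e0 lexx.
by apply/mapP; exists i; rewrite ?mem_enum.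
Qed.

(* After a generic perturbation of [x], the segment from [x] to [y] crosses the
   separating hyperplanes one at a time; we step over the first one. *)
Lemma exists_adjacent S s t : s \in regions a S -> t \in regions a S -> s != t ->
  exists2 r, r \in regions a S &
    exists i, [/\ i \in S, s i != t i, r i = t i & forall j, j != i -> r j = s j].
Proof.
case/regionP => x0 x0S -> /regionP[y yS ->] st.
(* Nonvanishing of these forms at [x] makes the crossing parameters of distinct separating
   hyperplanes differ. *)
have [||x [xs xg]] := @generic_point _ _ [seq a i | i <- enum S]
   [seq (ax p.2 y *: a p.1 + (- ax p.1 y) *: a p.2) |
     p <- [seq (i, j) | i <- enum S, j <- enum S] & p.1 != p.2] x0.
- by move=> b /mapP[i iS ->]; apply: x0S; rewrite mem_enum in iS.
- move=> b /mapP[[i j]]; rewrite mem_filter => /andP[/= ij /allpairsP[[i' j'] /= []]].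
  rewrite !mem_enum => iS jS [ii jj] ->; subst i' j'; apply/eqP => H.
  have [|/eqP] := @normals_indep i j (ax j y) (- ax i y) ij.
    by move=> x; rewrite -dotvZl -dotvDZl H dotvC dotv0.
  by rewrite (negbTE (yS j jS)).
have {}xs i : i \in S -> ax i x != 0 /\ (0 < ax i x) = (0 < ax i x0).
  by move=> iS; apply: xs; apply/mapP; exists i; rewrite ?mem_enum.
have {}xg i j : i \in S -> j \in S -> i != j -> ax j y * ax i x - ax i y * ax j x != 0.
  move=> iS jS ij; rewrite -mulNr -dotvZl -dotvDZl; apply: xg.
  apply/mapP; exists (i, j) => //; rewrite mem_filter /= ij /=.
  by apply/allpairsP; exists (i, j); rewrite !mem_enum.
have xS : avoids S x by move=> i /xs[].
have Ex : sgnv S x0 = sgnv S x.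
  by apply/ffunP => i; rewrite !ffunE; case: (boolP (i \in S)) => //= /xs[_ ->].
rewrite {}Ex in st *; clear x0S xs x0.
have [i0 i0D] : exists i0, i0 \in [set i in S | sgnv S x i != sgnv S y i].
  apply/set0Pn; apply: contra st => /eqP E; apply/eqP/ffunP => i.
  have := in_set0 i; rewrite -E !inE !ffunE; case: (i \in S) => //= /negbT.
  by rewrite negbK => /eqP.
have Dxy i : i \in [set i in S | sgnv S x i != sgnv S y i] ->
   [/\ i \in S, (0 < ax i x) != (0 < ax i y), ax i x != 0, ax i y != 0 & ax i x - ax i y != 0].
  rewrite !inE !ffunE => /andP[iS]; rewrite iS /= => ne; split; auto.
  by apply: contra ne; rewrite subr_eq0 => /eqP->.
(* The parameter at which the segment from [x] to [y] meets the hyperplane [i]; [i1] minimizes it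
   among the separating ones. *)
pose c i := ax i x / (ax i x - ax i y).
have [i1 i1D i1min] := @arg_minP _ _ _ i0 (mem [set i in S | sgnv S x i != sgnv S y i]) c i0D.
have [i1S ne1 x1 y1 xy1] := Dxy i1 i1D.
pose p := x + c i1 *: (y - x).
have pE j : ax j p = ax j x + c i1 * (ax j y - ax j x).
  by rewrite /ax dotvDZr -[- x]scaleN1r dotvDZr mulN1r.
have c01 : 0 < c i1 < 1.
  rewrite /c; case: (ltrgt0P (ax i1 x)) x1 ne1 => // x1 _; case: (ltrgt0P (ax i1 y)) y1 => // y1 _ _.
    have h : 0 < ax i1 x - ax i1 y by lra.
    by rewrite divr_gt0 // ltr_pdivrMr // mul1r; lra.
  have h : 0 < ax i1 y - ax i1 x by lra.
  by rewrite -[_ / _]divrNN opprB divr_gt0 ?oppr_gt0 // ltr_pdivrMr // mul1r; lra.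
have ps j : j \in S -> j != i1 -> ax j p != 0 /\ (0 < ax j p) = (0 < ax j x).
  move=> jS ji; case/andP: c01 => c0 c1.
  case: (boolP (j \in [set i in S | sgnv S x i != sgnv S y i])) => [jD|].
    have [_ nej xj yj xyj] := Dxy j jD.
    have pj : ax j p = (ax j x - ax j y) * (c j - c i1).
      by rewrite pE /c; field; rewrite xyj xy1.
    have cc : 0 < c j - c i1.
      have ij : i1 != j by rewrite eq_sym.
      rewrite subr_gt0 lt_neqAle i1min // andbT; apply: contra (xg _ _ i1S jS ij) => E.
      by move: E; rewrite /c eqr_div // => /eqP E; apply/eqP; lra.
    rewrite pj mulf_neq0 ?(gt_eqF cc) //; split => //; rewrite pmulr_lgt0 //.
    by case: (ltrgt0P (ax j x)) xj nej => // xj _; case: (ltrgt0P (ax j y)) yj => // yj _ _; lra.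
  rewrite !inE !ffunE jS /= negbK => /eqP E.
  have := xS j jS; have := yS j jS; move: E; rewrite pE.
  case: (ltrgt0P (ax j x)) => // xj; case: (ltrgt0P (ax j y)) => // yj _ _ _.
    have h : 0 < ax j x + c i1 * (ax j y - ax j x) by nra.
    by rewrite h gt_eqF.
  have h : ax j x + c i1 * (ax j y - ax j x) < 0 by nra.
  by rewrite lt_eqF // ltNge ltW.
have p1 : ax i1 p = 0 by rewrite pE /c; field.
(* The point [p] lies on the hyperplane [i1] only; a little further towards [y] exactly this one has
   been crossed. *)
have [|e e0 He] := @perturb_avoids (S :\ i1) p (y - x).
  by move=> j /setD1P[ji jS]; case: (ps j jS ji).
set q := p + e *: (y - x) in He.
have q1 : ax i1 q = e * (ax i1 y - ax i1 x).
  by rewrite /ax dotvDZr -/(ax _ _) p1 add0r -[- x]scaleN1r dotvDZr mulN1r.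
have q1n : ax i1 q != 0 by rewrite q1 mulf_neq0 ?(gt_eqF e0) // -opprB oppr_eq0.
exists (sgnv S q).
  apply/regionP; exists q => // j jS; case: (eqVneq j i1) => [-> //|ji].
  have jS' : j \in S :\ i1 by rewrite !inE ji.
  by case: (He j jS').
exists i1; split => //; first by rewrite !ffunE i1S.
  rewrite !ffunE i1S /= q1 pmulr_rgt0 //.
  by case: (ltrgt0P (ax i1 x)) x1 ne1 => // x1 _; case: (ltrgt0P (ax i1 y)) y1 => // y1 _ _; lra.
move=> j ji; rewrite !ffunE; case: (boolP (j \in S)) => //= jS.
have jS' : j \in S :\ i1 by rewrite !inE ji.
have [_ ->] := He j jS'.
by case: (ps j jS ji).
Qed.

End Arrangement.

(** * Towers of modular steps and the order by separating sets *)

Section Tower.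
Variables (R : realType) (d m : nat) (a : 'I_m -> 'rV[R]_d).
Hypothesis arr : arrangement a.
Implicit Types (S : {set 'I_m}) (s t B Q : {ffun 'I_m -> bool}) (x y v : 'rV[R]_d).

Let ax i x := dotv (a i) x.

Definition below B : rel {ffun 'I_m -> bool} :=
  fun s t => [forall i, (s i != B i) ==> (t i != B i)].

Definition opp B : {ffun 'I_m -> bool} := [ffun i => ~~ B i].

Lemma belowP B s t : reflect (forall i, s i != B i -> t i != B i) (below B s t).
Proof. exact: 'forall_implyP. Qed.

Lemma below_refl B s : below B s s.
Proof. exact/belowP. Qed.

Lemma below_trans B s t u : below B s t -> below B t u -> below B s u.
Proof. by move=> /belowP st /belowP tu; apply/belowP => i /st /tu. Qed.

Lemma below_anti B s t : below B s t -> below B t s -> s = t.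
Proof.
move=> /belowP st /belowP ts; apply/ffunP => i.
by have := st i; have := ts i; case: (s i); case: (t i); case: (B i) => //= h h'; try (by have := h isT); have := h' isT.
Qed.

Lemma below_opp B s t : below (opp B) s t = below B t s.
Proof.
by apply: eq_forallb => i; rewrite ffunE; case: (s i); case: (t i); case: (B i).
Qed.

(** The sign condition puts [B] on the side of [v] for every new hyperplane, so that [B] is at an
    end of its fibre. *)
Definition modular_step S0 S v B : Prop :=
  [/\ S0 \subset S, (forall k, k \in S0 -> ax k v = 0),
      (forall i, i \in S :\: S0 -> ax i v != 0 /\ B i = (0 < ax i v))
    & (forall i j, i \in S :\: S0 -> j \in S :\: S0 -> i != j ->
         exists2 k, k \in S0 & kernel_incl a i j k)].

Inductive tower : {set 'I_m} -> {ffun 'I_m -> bool} -> Prop :=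
| tower_nil B : tower set0 B
| tower_cons S0 S v B : tower S0 B -> modular_step S0 S v B -> tower S B.

Lemma modular_step_opp S0 S v B : modular_step S0 S v B -> modular_step S0 S (- v) (opp B).
Proof.
case=> sub H0 H1 H2; have Nv i : ax i (- v) = - ax i v by rewrite /ax -scaleN1r dotvZr mulN1r.
split=> //.
  by move=> k /H0; rewrite Nv => ->; rewrite oppr0.
move=> i /H1[n Bi]; rewrite Nv oppr_eq0 ffunE Bi; split=> //.
by rewrite oppr_gt0; case: (ltrgt0P (ax i v)) n.
Qed.

Lemma tower_opp S B : tower S B -> tower S (opp B).
Proof.
elim=> [B'|S0 S' v B' _ IH /modular_step_opp st]; first exact: tower_nil.
exact: tower_cons IH st.
Qed.

Lemma tower_ext S B : tower S B -> forall B', {in S, B =1 B'} -> tower S B'.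
Proof.
elim=> [B1|S0 S' v B1 _ IH [sub H0 H1 H2]] B' E; first exact: tower_nil.
apply: (@tower_cons S0 _ v); first by apply: IH => i iS; apply/E/(subsetP sub).
by split=> // i iS; have [iS' _] := setDP iS; rewrite -E //; apply: H1.
Qed.

(** * One modular step: crossing orders, regions as pairs, joins *)

Section Step.
Variables (S0 S : {set 'I_m}) (v : 'rV[R]_d) (B : {ffun 'I_m -> bool}).
Hypothesis step : modular_step S0 S v B.
Let S1 := S :\: S0.
(** The parameter [c] at which the line of points [x - c v] meets the hyperplane [i]. The line comes
    from the side of [B], so the hyperplanes crossed before reaching [x] are those with negative
    value. *)
Let f i x := ax i x / ax i v.
Let V := regions a S.
Let V0 := regions a S0.

Let sub : S0 \subset S. Proof. by case: step. Qed.

Lemma height_neg i x : i \in S1 -> ax i x != 0 -> ((0 < ax i x) != B i) = (f i x < 0).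
Proof.
case: step => _ _ H _ /H[v0 ->] x0.
have : f i x * ax i v = ax i x by rewrite /f divfK.
case: (ltrgt0P (ax i v)) v0 => // v0 _; case: (ltrgt0P (ax i x)) x0 => // x0 _;
  case: (ltrgt0P (f i x)) => //= h E; nra.
Qed.

(** Write [a k] as a combination of [a i] and [a j]. Since [a k] vanishes at [v], the coefficients
    make it proportional to the difference of heights, so the side of [k] decides which hyperplane
    is crossed first. *)
Lemma height_order i j : i \in S1 -> j \in S1 -> i != j ->
  exists2 k, k \in S0 & exists c, c != 0 /\ forall x, f i x - f j x = c * ax k x.
Proof.
case: step => _ H0 H1 H2 iS jS ij.
have [k kS /kernel_span H] := H2 i j iS jS ij.
have [vi _] := H1 i iS; have [vj _] := H1 j jS.
have neS l : l \in S1 -> k != l.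
  by move=> /setDP[_ lS0]; apply: contraNneq lS0 => <-.
have [c [e [c0 e0 kE]]] := H arr ij (neS i iS) (neS j jS).
exists k => //; exists (c * ax i v)^-1; split; first by rewrite invr_neq0 // mulf_neq0.
move=> x; have := kE v; rewrite -!/(ax _ _) H0 // => /esym /eqP.
rewrite addr_eq0 => /eqP E.
have -> : ax k x = (c * ax i v) * f i x + (e * ax j v) * f j x.
  by have := kE x; rewrite -!/(ax _ _) => ->; rewrite /f; field; rewrite vi vj.
by rewrite E; field; rewrite e0 vj.
Qed.

(* The order in which a line parallel to [v] inside the region [Q] of [S0]
   crosses the hyperplanes of [S1]. *)
Definition cross Q i j : bool :=
  `[< exists x, [/\ avoids a S0 x, Q = sgnv a S0 x & f i x < f j x] >].

Lemma cross_flip i j : i \in S1 -> j \in S1 -> i != j ->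
  exists2 k, k \in S0 & exists e : bool, forall x, avoids a S0 x ->
    f i x != f j x /\ (f i x < f j x) = (0 < ax k x) (+) e.
Proof.
move=> iS jS ij; have [k kS [c [c0 H]]] := height_order iS jS ij.
exists k => //; exists (0 < c) => x /(_ k kS) xk; have := H x.
rewrite -[f i x < f j x]subr_lt0 -[f i x == _]subr_eq0 => ->; split; first by rewrite mulf_neq0.
case: (ltrgt0P c) c0 => // c0 _; case: (ltrgt0P (ax k x)) xk => // xk _;
  case: (ltrgt0P (c * ax k x)) => //= h; nra.
Qed.

Lemma crossE i j x : i \in S1 -> j \in S1 -> avoids a S0 x ->
  cross (sgnv a S0 x) i j = (f i x < f j x).
Proof.
move=> iS jS xS; apply/asboolP/idP => [[y [yS E]]|]; last by exists x.
have [<-|ij] := eqVneq i j; first by rewrite ltxx.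
have [k kS [e H]] := cross_flip iS jS ij.
have [_ ->] := H y yS; have [_ ->] := H x xS.
by move/ffunP/(_ k): E; rewrite !ffunE kS /= => ->.
Qed.

Lemma cross_total Q i j : Q \in V0 -> i \in S1 -> j \in S1 -> i != j ->
  cross Q j i = ~~ cross Q i j.
Proof.
case/regionP => x xS -> iS jS ij; rewrite !crossE //.
have [k kS [e H]] := cross_flip iS jS ij.
by have [n _] := H x xS; case: ltrgtP n.
Qed.

Lemma cross_trans Q j i k : Q \in V0 -> i \in S1 -> j \in S1 -> k \in S1 ->
  cross Q i j -> cross Q j k -> cross Q i k.
Proof. by case/regionP => x xS -> iS jS kS; rewrite !crossE //; apply: lt_trans. Qed.

Lemma cross_change i j : i \in S1 -> j \in S1 -> i != j ->
  exists2 k, k \in S0 & forall P Q, P \in V0 -> Q \in V0 ->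
    P k = Q k -> cross P i j = cross Q i j.
Proof.
move=> iS jS ij; have [k kS [e H]] := cross_flip iS jS ij.
exists k => // _ _ /regionP[x xS ->] /regionP[y yS ->]; rewrite !crossE // !ffunE kS /= => E.
by have [_ ->] := H x xS; have [_ ->] := H y yS; rewrite E.
Qed.

Lemma separating_value (I : finType) (X Y : {set I}) (g : I -> R) :
  (forall i j, i \in X -> j \in Y -> g i < g j) ->
  exists c, (forall i, i \in X -> g i < c) /\ (forall j, j \in Y -> c < g j).
Proof.
move=> H; have [X0|[i0 i0X]] := set_0Vmem X; have [Y0|[j0 j0Y]] := set_0Vmem Y.
- by exists 0; rewrite X0 Y0; split => i; rewrite inE.
- have [j1 j1Y j1m] := @arg_minP _ _ _ j0 (mem Y) g j0Y.
  exists (g j1 - 1); rewrite X0; split => [i|j /j1m h]; [by rewrite inE | lra].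
- have [i1 i1X i1m] := @arg_maxP _ _ _ i0 (mem X) g i0X.
  have {}i1m i : i \in X -> g i <= g i1 := i1m i.
  exists (g i1 + 1); rewrite Y0; split => [i /i1m h|j]; [lra | by rewrite inE].
- have [i1 i1X i1m] := @arg_maxP _ _ _ i0 (mem X) g i0X.
  have {}i1m i : i \in X -> g i <= g i1 := i1m i.
  have [j1 j1Y j1m] := @arg_minP _ _ _ j0 (mem Y) g j0Y.
  have := H _ _ i1X j1Y => l; exists ((g i1 + g j1) / 2).
  by split => [i /i1m h|j /j1m h]; lra.
Qed.

(** At a point of the region, crossed hyperplanes have negative height and the others do not.
    Conversely, a value [c] separating the heights of the two groups tells how far to move along [v]
    from a point of the base region. *)
Lemma step_regionP s :
  s \in V <-> [/\ forall i, i \notin S -> s i = false, restr S0 s \in V0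
    & forall i j, i \in S1 -> j \in S1 -> s i != B i -> s j = B j -> cross (restr S0 s) i j].
Proof.
split=> [/regionP[x xS ->]|[s0 /regionP[x xS sx] Hc]].
  have xS0 := avoidsS sub xS.
  have val i : i \in S1 -> sgnv a S x i = (0 < ax i x).
    by move=> /setDP[iS _]; rewrite ffunE iS.
  have nz i : i \in S1 -> ax i x != 0 by move=> /setDP[iS _]; apply: xS.
  rewrite restr_sgnv //; split => [i /negbTE iS||i j iS jS].
  - by rewrite ffunE iS.
  - by apply/regionP; exists x.
  - rewrite !val // crossE // height_neg ?nz // => fi fj.
    by apply: (lt_le_trans fi); rewrite leNgt -height_neg ?nz // fj eqxx.
pose X := [set i in S1 | s i != B i]; pose Y := [set i in S1 | s i == B i].
have [|c [cX cY]] := @separating_value _ X Y (f^~ x).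
  move=> i j; rewrite !inE -!in_setD => /andP[iS si] /andP[jS /eqP sj].
  by rewrite -crossE // -sx; apply: Hc.
have [_ H0 H1 _] := step.
pose y := x + (- c) *: v.
have y0 k : k \in S0 -> ax k y = ax k x.
  by move=> kS; rewrite /ax dotvDZr -!/(ax _ _) H0 // mulr0 addr0.
have fy i : i \in S1 -> f i y = f i x - c.
  move=> iS; have [vi _] := H1 i iS.
  by rewrite /f /ax dotvDZr -!/(ax _ _); field.
have fy0 i : i \in S1 -> f i y != 0 /\ (f i y < 0) = (s i != B i).
  move=> iS; rewrite fy //; case: (boolP (s i == B i)) => si /=.
    by have := cY i; rewrite !inE -in_setD iS si => /(_ isT) l; split; [apply/eqP|apply/negP]; lra.
  by have := cX i; rewrite !inE -in_setD iS si => /(_ isT) l; split; [apply/eqP|]; lra.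
have yS : avoids a S y.
  move=> i iS; case: (boolP (i \in S0)) => iS0; first by rewrite -/(ax _ _) y0 //; apply: xS.
  have iS1 : i \in S1 by rewrite inE iS0.
  by have [n _] := fy0 i iS1; apply: contra n => /eqP; rewrite /f /ax => ->; rewrite mul0r.
apply/regionP; exists y => //; apply/ffunP => i; rewrite ffunE.
case: (boolP (i \in S)) => iS /=; last exact: s0.
case: (boolP (i \in S0)) => iS0.
  by rewrite -/(ax _ _) y0 //; move/ffunP/(_ i): sx; rewrite !ffunE iS0.
have iS1 : i \in S1 by rewrite inE iS0.
have [_] := fy0 i iS1; rewrite -height_neg //; last exact: yS.
by rewrite -/(ax _ _); case: (s i); case: (B i); case: (0 < ax i y).
Qed.

Lemma step_restr s : s \in V -> restr S0 s \in V0.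
Proof. by case/step_regionP. Qed.

Lemma restr_mono s t : below B s t -> below B (restr S0 s) (restr S0 t).
Proof.
by move=> /belowP H; apply/belowP => i; rewrite !ffunE; case: (i \in S0) => //=; apply: H.
Qed.

Lemma step_belowP s t : s \in V -> t \in V -> below B (restr S0 s) (restr S0 t) ->
  (forall i, i \in S1 -> s i != B i -> t i != B i) -> below B s t.
Proof.
move=> /step_regionP[s0 _ _] /step_regionP[t0 _ _] /belowP st H; apply/belowP => i.
case: (boolP (i \in S)) => iS; last by rewrite s0 ?t0.
case: (boolP (i \in S0)) => iS0; first by have := st i; rewrite !ffunE iS0.
by apply: H; rewrite inE iS0.
Qed.

(* The part of the join in [S1] is the down-closure, for the crossing order of
   the join in [S0], of the union of the two crossed sets. *)
Lemma step_lub :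
  {in V0 &, forall P Q, exists z, is_lub V0 (below B) P Q z} ->
  {in V &, forall s t, exists z, is_lub V (below B) s t z}.
Proof.
move=> L s t sV tV.
have [z [zV sz tz zmin]] := L _ _ (step_restr sV) (step_restr tV).
have [s0 _ sc] := (step_regionP s).1 sV; have [t0 _ tc] := (step_regionP t).1 tV.
pose P i := (s i != B i) || (t i != B i).
pose U j := [exists i in S1, P i && ((j == i) || cross z j i)].
have UP j : reflect (exists i, [/\ i \in S1, P i & (j == i) || cross z j i]) (U j).
  by apply: (iffP existsP) => -[i]; [case/and3P|case=> h1 h2 h3]; exists i => //; apply/and3P.
pose w : {ffun 'I_m -> bool} :=
  [ffun j => if j \in S0 then z j else (j \in S) && (B j (+) U j)].
have w1 j : j \in S1 -> (w j != B j) = U j.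
  by move=> /setDP[jS jS0]; rewrite ffunE (negbTE jS0) jS; case: (B j); case: (U j).
have wz : restr S0 w = z.
  apply/ffunP => i; rewrite !ffunE; case: (boolP (i \in S0)) => //= iS0.
  by case/regionP: zV => x _ ->; rewrite ffunE (negbTE iS0).
have wV : w \in V.
  apply/step_regionP; split; rewrite ?wz //.
    move=> i iS; rewrite ffunE (negbTE iS) ifN //.
    by apply: contra iS => /(subsetP sub).
  move=> i j iS jS; rewrite w1 // => /UP[k [kS Pk ik]] /eqP.
  rewrite -[_ == _]negbK w1 // => jU.
  have ij : i != j by apply: contraNneq jU => <-; apply/UP; exists k.
  rewrite cross_total // 1?eq_sym //; apply/negP => ji; case/negP: jU.
  apply/UP; exists k; split => //; case/orP: ik => [/eqP<-|ik]; first by rewrite ji orbT.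
  by rewrite (cross_trans zV jS iS kS ji ik) orbT.
exists w; split => //.
- apply: step_belowP; rewrite ?wz // => i iS si; rewrite w1 //; apply/UP; exists i.
  by rewrite eqxx /P si.
- apply: step_belowP; rewrite ?wz // => i iS si; rewrite w1 //; apply/UP; exists i.
  by rewrite eqxx /P si orbT.
move=> u uV su tu; have uV0 := step_restr uV.
have zu : below B z (restr S0 u) by apply: zmin => //; apply: restr_mono.
have [u0 _ uc] := (step_regionP u).1 uV.
apply: step_belowP; rewrite ?wz // => j jS; rewrite w1 // => /UP[i [iS Pi /orP[/eqP->|ji]]].
  by case/orP: Pi; move: i {iS}; apply/belowP.
(* If [u] has not crossed [j], then [i] precedes [j] at [u], whereas [j] precedes [i] at [z]. The
   hyperplane [k] of [S0] deciding this pair separates [z] from [u]; as [z] is below [u], it lies on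
   the side of [B] for [k]. *)
case: (boolP (u j == B j)) => [/eqP ju|//].
have ui : u i != B i by case/orP: Pi; move: i {iS ji}; apply/belowP.
have cu := uc _ _ iS jS ui ju.
have ij : i != j by apply: contraNneq ui => ->; rewrite ju.
have [k kS kP] := cross_change iS jS ij.
have zk : z k != restr S0 u k.
  apply/negP => /eqP E; move: ji; rewrite cross_total //.
  by rewrite (kP _ _ zV uV0 E) cu.
have zkB : z k = B k.
  by move/belowP/(_ k): zu zk; case: (z k); case: (restr S0 u k); case: (B k) => //= h; have := h isT.
(* The pair [i, j] is reversed between [z] and [u] only, so [s] and [t] order it as [z] does. *)
have low r : r \in V -> below B (restr S0 r) z -> r i != B i -> r j != B j.
  move=> rV /belowP/(_ k) rz ri; apply/eqP => rj.
  have [_ rV0 rc] := (step_regionP r).1 rV.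
  have rk : restr S0 r k = z k.
    by move: rz; rewrite zkB eqxx; case: eqP => // _ /(_ isT).
  move: ji; rewrite cross_total // -(kP _ _ rV0 zV rk).
  by rewrite rc.
by case/orP: Pi => [/(low s sV sz)|/(low t tV tz)];
   [move/belowP: su|move/belowP: tu] => /(_ j); rewrite ju eqxx => h /h.
Qed.

End Step.
End Tower.

Lemma eq_in_lattice (T : finType) (V : {set T}) (le le' : rel T) :
  {in V &, le =2 le'} -> is_lattice V le -> is_lattice V le'.
Proof.
move=> E [[rf an tr] L]; split; first split.
- by move=> x xV; rewrite -E // rf.
- by move=> x y xV yV; rewrite -!E //; apply: an.
- by move=> x y z xV yV zV; rewrite -!E //; apply: tr.
move=> x y xV yV; have [[z [zV xz yz zm]] [w [wV wx wy wm]]] := L x y xV yV; split.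
  by exists z; split; rewrite -?E // => u uV; rewrite -!E //; apply: zm.
by exists w; split; rewrite -?E // => u uV; rewrite -!E //; apply: wm.
Qed.

(** * Lattice property and Hamiltonian paths for towers *)

Section TowerLattice.
Variables (R : realType) (d m : nat) (a : 'I_m -> 'rV[R]_d).
Hypothesis arr : arrangement a.
Implicit Types (S : {set 'I_m}) (s t B Q : {ffun 'I_m -> bool}) (x y v : 'rV[R]_d).

Let ax i x := dotv (a i) x.

Lemma regions_set0 : regions a set0 = [set [ffun=> false]].
Proof.
apply/setP => s; rewrite in_set1; apply/regionP/eqP => [[x _ ->]|->].
  by apply/ffunP => i; rewrite !ffunE inE.
by exists 0 => [i|]; rewrite ?inE //; apply/ffunP => i; rewrite !ffunE inE.
Qed.

Lemma tower_lub S B : tower a S B ->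
  {in regions a S &, forall s t, exists z, is_lub (regions a S) (below B) s t z}.
Proof.
elim=> [B'|S0 S' v B' _ IH step]; last exact: (step_lub arr step).
move=> s t; rewrite regions_set0 !in_set1 => /eqP-> /eqP->.
by exists [ffun=> false]; split; rewrite ?in_set1 ?below_refl.
Qed.

Lemma tower_lattice S B : tower a S B -> is_lattice (regions a S) (below B).
Proof.
move=> tw; split.
  split=> [s _|s t _ _|s t u _ _ _]; [exact: below_refl|exact: below_anti|exact: below_trans].
move=> s t sV tV; split; first exact: tower_lub.
have [z [zV sz tz zm]] := tower_lub (tower_opp tw) sV tV.
rewrite !below_opp in sz tz; exists z; split=> // w wV ws wt.
by have := zm w wV; rewrite !below_opp; apply.
Qed.

Section FibreEnds.
Variables (S0 S : {set 'I_m}) (v : 'rV[R]_d) (B : {ffun 'I_m -> bool}).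
Hypothesis step : modular_step a S0 S v B.

(* The bottom ([b = false]) and top ([b = true]) of the fibre over a region of [S0]. *)
Definition fibre_end (b : bool) Q : {ffun 'I_m -> bool} :=
  [ffun i => if i \in S0 then Q i else (i \in S) && (b (+) B i)].

Lemma fibre_endE b Q i : i \in S :\: S0 -> fibre_end b Q i = b (+) B i.
Proof. by move=> /setDP[iS /negbTE iS0]; rewrite ffunE iS0 iS. Qed.

Lemma restr_fibre_end b : {in regions a S0, forall Q, restr S0 (fibre_end b Q) = Q}.
Proof.
move=> Q /regionP[x _ ->]; apply/ffunP => i; rewrite !ffunE.
by case: (i \in S0).
Qed.

Lemma fibre_end_region b : {in regions a S0, forall Q, fibre_end b Q \in regions a S}.
Proof.
move=> Q QV; apply/(step_regionP arr step); rewrite restr_fibre_end //; split=> //.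
  move=> i iS; rewrite ffunE (negbTE iS) ifN //.
  by have [/subsetP sub _ _ _] := step; apply: contra iS => /sub.
by move=> i j iS jS; rewrite !fibre_endE //; case: b; case: (B i); case: (B j).
Qed.

Lemma fibre_end_mono b : {in regions a S0 &, forall P Q, below B P Q ->
  below B (fibre_end b P) (fibre_end b Q)}.
Proof.
move=> P Q PV QV PQ; apply: (step_belowP arr step); rewrite ?fibre_end_region ?restr_fibre_end //.
by move=> i iS; rewrite !fibre_endE.
Qed.

(** Both regions are initial segments of one and the same crossing order, hence nested. *)
Lemma fibre_total : {in regions a S &, forall s t, restr S0 s = restr S0 t ->
  below B s t || below B t s}.
Proof.
move=> s t sV tV E; apply/orP.
case: (boolP [exists i in S :\: S0, (s i != B i) && (t i == B i)]) => [|H]; last first.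
  left; apply: (step_belowP arr step); rewrite // ?E ?below_refl // => i iS si.
  by apply: contra H => ti; apply/existsP; exists i; rewrite iS si.
case/existsP => i /and3P[iS si /eqP ti]; right.
apply: (step_belowP arr step); rewrite // ?E ?below_refl // => j jS tj.
apply/negP => /eqP sj; have [_ V0 sc] := (step_regionP arr step s).1 sV.
have [_ _ tc] := (step_regionP arr step t).1 tV.
have ij : i != j by apply: contraNneq si => ->; rewrite sj.
have := sc _ _ iS jS si sj; have := tc _ _ jS iS tj ti.
by rewrite -E (cross_total arr step) // => /negbTE->.
Qed.

(** The order [le] need only agree with [below B] on regions, so that the graph order can be
    substituted later. *)
Lemma step_hamiltonian (le : rel {ffun 'I_m -> bool}) :
  is_lattice (regions a S0) (below B) ->
  is_lattice (regions a S) le -> {in regions a S &, below B =2 le} ->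
  (forall eqv0, lattice_congruence (regions a S0) (below B) eqv0 ->
     hamiltonian_path (classes (regions a S0) eqv0) (qcover (regions a S0) (below B) eqv0)) ->
  forall eqv, lattice_congruence (regions a S) le eqv ->
    hamiltonian_path (classes (regions a S) eqv) (qcover (regions a S) le eqv).
Proof.
move=> lat0 lat E H eqv cong.
have eV := fibre_end_region; have rV s := @step_restr _ _ _ _ arr _ _ _ _ step s.
apply: (fibred_hamiltonian (rho := restr S0) (bot := fibre_end false) (top := fibre_end true)
  lat lat0 _ _ _ _ _ _ _ _ _ _ _ _ _ cong H); try exact: eV; try exact: restr_fibre_end.
- exact: rV.
- by move=> x y xV yV; rewrite -E //; apply: restr_mono.
- by move=> P Q PV QV PQ; rewrite -E ?eV //; apply: fibre_end_mono.
- by move=> P Q PV QV PQ; rewrite -E ?eV //; apply: fibre_end_mono.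
- move=> s sV; have s0V := rV _ sV; rewrite -E ?eV //.
  apply: (step_belowP arr step); rewrite ?eV ?restr_fibre_end ?below_refl // => i iS.
  by rewrite fibre_endE ?eqxx.
- move=> s sV; have s0V := rV _ sV; rewrite -E ?eV //.
  apply: (step_belowP arr step); rewrite ?eV ?restr_fibre_end ?below_refl // => i iS _.
  by rewrite fibre_endE //; case: (B i).
- move=> s Q sV QV; have s0V := rV _ sV; rewrite -E ?eV // => /belowP sQ.
  apply: (@below_anti _ B); apply: (step_belowP arr step);
    rewrite ?eV ?restr_fibre_end ?below_refl // => i iS.
    by move/sQ; rewrite !fibre_endE.
  by rewrite fibre_endE ?eqxx.
- move=> s Q sV QV; have s0V := rV _ sV; rewrite -E ?eV // => /belowP sQ.
  apply: (@below_anti _ B); apply: (step_belowP arr step);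
    rewrite ?eV ?restr_fibre_end ?below_refl // => i iS _.
    by rewrite fibre_endE //; case: (B i).
  by apply: sQ; rewrite fibre_endE //; case: (B i).
- by move=> s t sV tV st; rewrite -!E //; apply: fibre_total.
Qed.

End FibreEnds.

Lemma tower_hamiltonian S B : tower a S B ->
  forall le, {in regions a S &, below B =2 le} ->
  forall eqv, lattice_congruence (regions a S) le eqv ->
    hamiltonian_path (classes (regions a S) eqv) (qcover (regions a S) le eqv).
Proof.
elim=> [B'|S0 S' v B' tw IH step] le E eqv cong.
  exists [set y in regions a set0 | eqv [ffun=> false] y], [::]; split => // X.
  rewrite mem_seq1; apply/eqP/imsetP => [->|[s]].
    by exists [ffun=> false]; rewrite // regions_set0 set11.
  by move=> + ->; rewrite {1}regions_set0 => /set1P->.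
have lat := eq_in_lattice E (tower_lattice (tower_cons tw step)).
apply: (step_hamiltonian step (tower_lattice tw) lat E _ cong).
exact: IH.
Qed.

End TowerLattice.

(** * Orienting a modular step by an end of a fibre path *)

Section CanonicalTower.
Variables (R : realType) (d m : nat) (a : 'I_m -> 'rV[R]_d).
Hypothesis arr : arrangement a.
Implicit Types (S : {set 'I_m}) (s t B Q : {ffun 'I_m -> bool}) (x y v : 'rV[R]_d).

Let ax i x := dotv (a i) x.

Definition positive_side v : {ffun 'I_m -> bool} := [ffun i => 0 < ax i v].

Lemma modular_stepI S0 S v : S0 \subset S -> (forall k, k \in S0 -> ax k v = 0) ->
  (exists2 i, i \in S :\: S0 & ax i v != 0) ->
  (forall i j, i \in S :\: S0 -> j \in S :\: S0 -> i != j ->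
         exists2 k, k \in S0 & kernel_incl a i j k) ->
  modular_step a S0 S v (positive_side v).
Proof.
move=> sub v0 [i iS vi] H; split=> // j jS; rewrite ffunE; split=> //.
have [<- //|ij] := eqVneq i j.
have [k kS /(kernel_span arr ij)] := H i j iS jS ij.
have neS l : l \in S :\: S0 -> k != l.
  by move=> /setDP[_ lS0]; apply: contraNneq lS0 => <-.
move=> /(_ (neS i iS) (neS j jS))[c [e [c0 e0 /(_ v)]]].
rewrite -!/(ax _ _) v0 // => /eqP; apply: contraTneq => ->.
by rewrite mulr0 addr0 eq_sym mulf_neq0.
Qed.

Lemma modular_step_oriented S0 S v B B' : modular_step a S0 S v B ->
  (forall i, i \in S :\: S0 -> B' i = B i) \/ (forall i, i \in S :\: S0 -> B' i != B i) ->
  exists w, modular_step a S0 S w B'.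
Proof.
move=> step [H|H]; [exists v|exists (- v); move/modular_step_opp: step => step];
  case: step => sub h0 h1 h2; split=> // i iS.
- by rewrite H //; apply: h1.
- have [n] := h1 i iS; rewrite ffunE => E; split=> //.
  by move: (H i iS) E; case: (B i); case: (B' i) => //= _ <-.
Qed.

(** Step towards the region of [v + e x] with [x] in [s] and [e] small: it agrees with [s] on [S0]
    and with [v] on the new hyperplanes, so the one crossed is new. *)
Lemma neighbour_towards S0 S s v : S0 \subset S -> s \in regions a S ->
  (forall k, k \in S0 -> ax k v = 0) -> (forall i, i \in S :\: S0 -> ax i v != 0) ->
  (exists2 i, i \in S :\: S0 & s i != (0 < ax i v)) ->
  exists2 t, adj a S s t && (restr S0 t == restr S0 s) &
    exists i, [/\ i \in S :\: S0, s i != t i, s i != (0 < ax i v) & forall j, j != i -> t j = s j].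
Proof.
move=> sub sV v0 v1 [i0 i0S si0]; case/regionP: (sV) => x xS sx.
have [i iS|e e0 He] := @perturb_avoids _ _ _ a (S :\: S0) v x; first exact: v1.
pose y := v + e *: x.
have y0 k : k \in S0 -> ax k y != 0 /\ (0 < ax k y) = (0 < ax k x).
  move=> kS; have := xS k ((subsetP sub) k kS).
  rewrite /ax dotvDZr -!/(ax _ _) v0 // add0r pmulr_rgt0 // => n; split=> //.
  by rewrite mulf_neq0 // gt_eqF.
have yV : sgnv a S y \in regions a S.
  apply/regionP; exists y => // i iS; case: (boolP (i \in S0)) => [/y0[] //|iS0].
  by case: (He i) => //; rewrite inE iS0.
have neq : s != sgnv a S y.
  apply: contra si0 => /eqP->; have [iS _] := setDP i0S.
  by rewrite ffunE iS /=; case: (He i0 i0S) => _ ->.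
have [t tV [i [iS sti ti tj]]] := exists_adjacent arr sV yV neq.
have iS0 : i \notin S0.
  apply: contra sti => iS0; rewrite sx !ffunE iS /= -!/(ax _ _).
  by have [_ ->] := y0 i iS0.
have st : s i != t i by rewrite ti.
exists t.
  apply/andP; split.
    rewrite /adj sV tV /=; apply/eqP; rewrite -(cards1 i); congr #|pred_of_set _|.
    apply/setP => j; rewrite !inE; have [->|ji] := eqVneq j i; first by rewrite iS.
    by rewrite tj // eqxx andbF.
  apply/eqP/ffunP => j; rewrite !ffunE; have [->|ji] := eqVneq j i; first by rewrite (negbTE iS0).
  by rewrite tj.
have iSD : i \in S :\: S0 by rewrite inE iS0.
exists i; split=> //.
by move: sti; rewrite ffunE iS /=; case: (He i iSD) => _ ->.
Qed.

(** A region on the side of [v] for some new hyperplanes but not for all has one neighbour towards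
    [v] and another towards [-v], both in its fibre. *)
Lemma end_of_fibre S0 S s v : S0 \subset S -> s \in regions a S ->
  (forall k, k \in S0 -> ax k v = 0) -> (forall i, i \in S :\: S0 -> ax i v != 0) ->
  (#|[set t | adj a S s t & restr S0 t == restr S0 s]| <= 1)%N ->
  (forall i, i \in S :\: S0 -> s i = positive_side v i) \/
  (forall i, i \in S :\: S0 -> s i != positive_side v i).
Proof.
move=> sub sV v0 v1 card.
case: (boolP [exists i in S :\: S0, s i != (0 < ax i v)]) => [/existsP[i /andP[iS si]]|H]; last first.
  left=> i iS; rewrite ffunE; apply/eqP; apply: contraNT H => n.
  by apply/existsP; exists i; rewrite iS.
right=> j jS; rewrite ffunE; apply/negP => /eqP sj.
have Nv l : ax l (- v) = - ax l v by rewrite /ax -scaleN1r dotvZr mulN1r.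
have opp_side l : l \in S :\: S0 -> (0 < ax l (- v)) = ~~ (0 < ax l v).
  by move=> /v1; rewrite Nv oppr_gt0; case: (ltrgt0P (ax l v)).
have [t1 a1 [i1 [S1 n1 d1 e1]]] : exists2 t, adj a S s t && (restr S0 t == restr S0 s) &
    exists i, [/\ i \in S :\: S0, s i != t i, s i != (0 < ax i v) & forall j, j != i -> t j = s j].
  by apply: neighbour_towards => //; exists i.
have [|||t2 a2 [i2 [_ n2 d2 e2]]] := @neighbour_towards S0 S s (- v) sub sV.
- by move=> k kS; rewrite Nv v0 // oppr0.
- by move=> l lS; rewrite Nv oppr_eq0 v1.
- by exists j; rewrite // opp_side // sj; case: (0 < _).
have t12 : t1 != t2.
  apply/eqP => E; have ii : i1 = i2.
    by apply/eqP; apply: contraNT n1 => n; rewrite E e2.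
  by subst i2; move: d1 d2; rewrite opp_side //; case: (s i1); case: (0 < ax i1 v).
have : ([set t1; t2] \subset [set t | adj a S s t & restr S0 t == restr S0 s]).
  by apply/subsetP => t; rewrite !inE => /orP[] /eqP->.
by move=> /subset_leq_card; rewrite cards2 t12 => /leq_trans/(_ card).
Qed.

End CanonicalTower.

(** * From a decomposition and a canonical region to a tower *)

Section ChainTower.
Variables (R : realType) (d m : nat) (a : 'I_m -> 'rV[R]_d).
Hypothesis arr : arrangement a.
Implicit Types (S : {set 'I_m}) (s t B Q : {ffun 'I_m -> bool}) (x y v : 'rV[R]_d).

Let ax i x := dotv (a i) x.
Let normals S : 'M[R]_(m, d) := \matrix_(i < m) (if i \in S then a i else 0).

Lemma normal_sub S i : i \in S -> (a i <= normals S)%MS.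
Proof. by move=> iS; have := row_sub i (normals S); rewrite rowK iS. Qed.

(** Three normals of an arrangement of rank at most 2 are dependent; if [a k] were nonzero at [x],
    its coefficient would vanish, contradicting the independence of [a i] and [a j]. *)
Lemma rank2_kernel_incl S i j k : (arr_rank a S <= 2)%N -> i \in S -> j \in S -> k \in S ->
  i != j -> kernel_incl a i j k.
Proof.
move=> rk iS jS kS ij x xi xj; pose M : 'M[R]_(3, d) := \matrix_(r < 3) a (tnth [tuple i; j; k] r).
have MS : (M <= normals S)%MS.
  apply/row_subP => r; rewrite rowK; apply: normal_sub.
  by case: r => [[|[|[|//]]] p].
have : ~~ row_free M.
  by rewrite /row_free neq_ltn (leq_ltn_trans (leq_trans (mxrankS MS) rk)).
rewrite -kermx_eq0 => /rowV0Pn[u /sub_kermxP uM u0].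
pose r0 : 'I_3 := ord0; pose r1 : 'I_3 := lift ord0 ord0; pose r2 : 'I_3 := lift ord0 (lift ord0 ord0).
have rel y : u ord0 r0 * ax i y + u ord0 r1 * ax j y + u ord0 r2 * ax k y = 0.
  move: uM; rewrite mulmx_sum_row !big_ord_recl big_ord0 addr0 !rowK -/r0 -/r1 -/r2.
  rewrite !(tnth_nth i) /= addrA => /(congr1 (fun w : 'rV_d => dotv w y)).
  by rewrite !dotvDZl dotvZl [dotv 0 y]dotvC dotv0.
apply/eqP; apply: contraNT u0 => xk; apply/eqP/rowP => r; rewrite mxE.
have u2 : u ord0 r2 = 0.
  by have /eqP := rel x; rewrite /ax xi xj !mulr0 !add0r mulf_eq0 (negbTE xk) orbF => /eqP.
have [|u00 u1] := @normals_indep _ _ _ _ arr i j (u ord0 r0) (u ord0 r1) ij.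
  by move=> y; have := rel y; rewrite u2 mul0r addr0.
case: r => [[|[|[|//]]] p]; [rewrite -u00|rewrite -u1|rewrite -u2]; congr (u _ _); exact: val_inj.
Qed.

(** The columns of the cokernel of the normals of [S0] are orthogonal to all of these; were they all
    orthogonal to [S] too, the row space of [S] would lie in that of [S0]. *)
Lemma transverse_direction S0 S : (arr_rank a S0 < arr_rank a S)%N ->
  exists2 v, forall k, k \in S0 -> ax k v = 0 & exists2 i, i \in S :\: S0 & ax i v != 0.
Proof.
move=> rk; have : ~~ (normals S <= normals S0)%MS.
  by apply: contraL rk => /mxrankS; rewrite -leqNgt.
set C := cokermx (normals S0).
have E S' i c : (normals S' *m C) i c = if i \in S' then ax i (col c C)^T else 0.
  rewrite !mxE; case: ifP => iS'.
    by apply: eq_bigr => l _; rewrite !mxE iS'.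
  by apply: big1 => l _; rewrite !mxE iS' mxE mul0r.
rewrite submxE -/C => nz.
have [i [c ic]] : exists i c, (normals S *m C) i c != 0.
  have [[i c] ic] : exists p : 'I_m * 'I_d, (normals S *m C) p.1 p.2 != 0; last by exists i, c.
  apply/existsP; apply: contraNT nz => /existsPn H; apply/eqP/matrixP => i c.
  by have /negPn/eqP /= -> := H (i, c); rewrite mxE.
have z k : k \in S0 -> ax k (col c C)^T = 0.
  by move=> kS; have := E S0 k c; rewrite kS mulmx_coker mxE.
exists (col c C)^T => //; move: ic; rewrite E; case: ifP; rewrite ?eqxx // => iS n.
exists i => //; rewrite inE iS andbT; apply: contra n => /z->; exact: eqxx.
Qed.

(* In rank 2 any wall [k] of the region may serve as the modular hyperplane. *)
Lemma rank2_tower S s : (arr_rank a S <= 2)%N -> s \in regions a S -> tower a S s.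
Proof.
move=> rk sV; have [->|[i0 i0S]] := set_0Vmem S; first exact: tower_nil.
case/regionP: (sV) => x xS sx.
have Nx i : ax i (- x) = - ax i x by rewrite /ax -scaleN1r dotvZr mulN1r.
have xN : sgnv a S (- x) \in regions a S.
  by apply/regionP; exists (- x) => // i iS; rewrite -/(ax _ _) Nx oppr_eq0; apply: xS.
have neq : s != sgnv a S (- x).
  apply/eqP => /ffunP/(_ i0); rewrite sx !ffunE i0S /= -!/(ax _ _) Nx oppr_gt0.
  by have := xS i0 i0S; rewrite -/(ax _ _); case: (ltrgt0P (ax i0 x)).
(* The wall [k] is the first hyperplane crossed on the way to the antipodal region, and [r] is the
   region behind it. *)
have [r rV [k [kS sk rk' rj]]] := exists_adjacent arr sV xN neq.
have {}sk : s k != r k by rewrite rk'.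
case/regionP: (rV) => y yS ry.
have step1 : exists v, modular_step a set0 [set k] v s.
  apply: (@modular_step_oriented _ _ _ _ _ _ (a k) (positive_side a (a k))).
    apply: (modular_stepI arr); first exact: sub0set.
    - by move=> l; rewrite inE.
    - by exists k; [rewrite !inE eqxx | rewrite dotvv_eq0; apply: arr.1].
    - by move=> i j; rewrite !inE /= => /eqP-> /eqP-> /negP[].
  case: (eqVneq (s k) (positive_side a (a k) k)) => H; [left|right];
    by move=> i; rewrite !inE /= => /eqP->.
have [v1 {}step1] := step1.
have tw1 := tower_cons (tower_nil a s) step1.
have sub : [set k] \subset S by rewrite sub1set.
have ker i j : i \in S :\: [set k] -> j \in S :\: [set k] -> i != j ->
    exists2 l, l \in [set k] & kernel_incl a i j l.
  move=> /setDP[iS _] /setDP[jS _] ij; exists k; first exact: set11.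
  exact: (rank2_kernel_incl rk).
have [v2 step2] : exists v, modular_step a [set k] S v s.
  have [S0|[i /setDP[iS ik]]] := set_0Vmem (S :\: [set k]).
    exists 0; split=> //.
    - by move=> l _; rewrite dotv0.
    - by move=> i; rewrite S0 inE.
  rewrite inE in ik; have [u [iu ku]] := normals_dual arr ik.
  have step : modular_step a [set k] S u (positive_side a u).
    apply: (modular_stepI arr) => //; first by move=> l /set1P->.
    by exists i => //; rewrite !inE ik.
  apply: (modular_step_oriented step).
  case: (boolP [exists j in S :\: [set k], s j != positive_side a u j]) => [|H]; last first.
    left=> j jS; apply/eqP; apply: contraNT H => n; by apply/existsP; exists j; rewrite jS.
  case/existsP => j /andP[jS nj]; right=> l lS; apply/negP => /eqP sl.
  have lj : l != j by apply: contraNneq nj => <-; rewrite sl.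
  (* Regions [s] and [r] differ only at [k], so at both points [x] and [y] the height of [j] is
     negative and that of [l] is not. Their difference is a multiple of [a k], which however has
     opposite signs at [x] and [y]. *)
  have [k' /set1P-> [c [c0 hc]]] := height_order arr step lS jS lj.
  have val h (z : 'rV[R]_d) : h \in S :\: [set k] -> avoids a S z ->
      (s h = (0 < ax h z)) -> (s h != positive_side a u h) = (ax h z / ax h u < 0).
    move=> hS zS ->; rewrite (height_neg step hS) //; apply: zS; by case/setDP: hS.
  have sxE h : h \in S -> s h = (0 < ax h x) by move=> hS; rewrite sx ffunE hS.
  have syE h : h \in S -> h != k -> s h = (0 < ax h y).
    by move=> hS hk; rewrite -rj // ry ffunE hS.
  have [[lS' lk] [jS' jk]] := (setDP lS, setDP jS); rewrite inE in lk; rewrite inE in jk.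
  have := val l x lS xS (sxE l lS'); have := val l y lS yS (syE l lS' lk).
  have := val j x jS xS (sxE j jS'); have := val j y jS yS (syE j jS' jk).
  rewrite nj sl eqxx; move=> /esym jy /esym jx /esym/negbT ly /esym/negbT lx.
  rewrite -leNgt in ly; rewrite -leNgt in lx.
  have hx := hc x; have hy := hc y.
  have px : 0 < c * ax k x by rewrite /ax -hx subr_gt0; apply: lt_le_trans lx; rewrite jx.
  have py : 0 < c * ax k y by rewrite /ax -hy subr_gt0; apply: lt_le_trans ly; rewrite jy.
  move: sk; rewrite sx ry !ffunE kS /= -!/(ax _ _).
  have := xS k kS; have := yS k kS; rewrite -!/(ax _ _).
  case: (ltrgt0P (ax k x)) => // kx; case: (ltrgt0P (ax k y)) => // ky _ _ _;
    clear -px py kx ky; nra.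
exact: tower_cons tw1 step2.
Qed.

(** The drop in rank yields a direction [v] for each step, and being at an end of the fibre path
    orients it by [s]. *)
Lemma chain_tower ch S s : ss_chain a S ch -> s \in regions a S ->
  canonical_region a S ch s -> tower a S s.
Proof.
elim: ch S s => [|S0 ch IH] S s /=; first by move=> rk sV _; apply: rank2_tower.
move=> [[rk /proper_sub sub _ rk0] [ker chS]] sV [can0 card].
have [v v0 vi] : exists2 v, forall k, k \in S0 -> ax k v = 0 & exists2 i, i \in S :\: S0 & ax i v != 0.
  by apply: transverse_direction; rewrite rk0 prednK // (leq_trans _ rk).
have step := modular_stepI arr sub v0 vi ker.
have [w {}step] : exists w, modular_step a S0 S w s.
  apply: (modular_step_oriented step); apply: (end_of_fibre arr sub sV v0 _ card).
  by move=> i; case: step => _ _ H _ /H[].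
(* Sign vectors of regions of [S0] vanish outside [S0], so the recursion runs on the restriction of
   [s]. *)
apply: tower_cons step; apply: (@tower_ext _ _ _ _ _ (restr S0 s)).
  apply: IH => //; case/regionP: sV => x xS ->; rewrite restr_sgnv //.
  by apply/regionP; exists x => //; apply: avoidsS xS.
by move=> i iS; rewrite ffunE iS.
Qed.

End ChainTower.

(** * Graph distance as number of separating hyperplanes, and the order it defines *)

Section GraphDistance.
Variables (R : realType) (d m : nat) (a : 'I_m -> 'rV[R]_d) (S : {set 'I_m}).
Hypothesis arr : arrangement a.
Implicit Types (s t r B : {ffun 'I_m -> bool}).

Definition separating s t := [set i in S | s i != t i].

Lemma separatingC s t : separating s t = separating t s.
Proof. by apply/setP => i; rewrite !inE eq_sym. Qed.

Lemma region_out s i : s \in regions a S -> i \notin S -> s i = false.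
Proof. by case/regionP => x _ -> /negbTE iS; rewrite ffunE iS. Qed.

Lemma adj_flip s r i : s \in regions a S -> r \in regions a S -> i \in S -> s i != r i ->
  (forall j, j != i -> r j = s j) -> adj a S s r.
Proof.
move=> sV rV iS si rj; rewrite /adj sV rV /= -(cards1 i); apply/eqP; congr #|pred_of_set _|.
apply/setP => j; rewrite !inE; have [->|ji] := eqVneq j i; first by rewrite iS si.
by rewrite rj // eqxx andbF.
Qed.

Lemma adjP s t : adj a S s t ->
  exists i, [/\ i \in S, s i != t i & forall j, j != i -> t j = s j].
Proof.
case/and3P => sV tV /cards1P[i E]; exists i.
have /[!inE] /andP[iS si] : i \in [set i in S | s i != t i] by rewrite E set11.
split=> // j ji; have [jS|jS] := boolP (j \in S); last by rewrite !region_out.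
by apply/esym/eqP; apply: contraNT ji => n; rewrite -in_set1 -E inE jS.
Qed.

Lemma walk_lower_bound s p : path (adj a S) s p -> (#|separating s (last s p)| <= size p)%N.
Proof.
elim: p s => [|t p IH] s /=.
  by move=> _; rewrite /separating leqn0 cards_eq0; apply/eqP/setP => i; rewrite !inE eqxx andbF.
move=> /andP[/adjP[i [iS si tj]] /IH le]; apply: leq_trans (_ : #|i |: separating t (last t p)| <= _)%N.
  apply/subset_leq_card/subsetP => j; rewrite !inE => /andP[jS].
  by rewrite jS; have [//|ji] := eqVneq j i; rewrite tj.
by rewrite cardsU1 -add1n leq_add // leq_b1.
Qed.

Lemma separating_flip s t r i : i \in S -> s i != t i -> r i = t i ->
  (forall j, j != i -> r j = s j) -> #|separating s t| = #|separating r t|.+1.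
Proof.
move=> iS si ri rj; rewrite (cardsD1 i) inE iS si add1n; congr _.+1.
apply: eq_card => j; rewrite !inE; have [->|ji] := eqVneq j i; first by rewrite ri eqxx andbF.
by rewrite rj.
Qed.

Lemma separating_eq0 s t : s \in regions a S -> t \in regions a S ->
  #|separating s t| = 0%N -> s = t.
Proof.
move=> sV tV /eqP; rewrite cards_eq0 => /eqP E; apply/ffunP => i.
have [iS|iS] := boolP (i \in S); last by rewrite !region_out.
by apply/eqP; have := in_set0 i; rewrite -E inE iS => /negbFE.
Qed.

(** Each step of [exists_adjacent] removes exactly one separating hyperplane. *)
Lemma geodesic_exists s t : s \in regions a S -> t \in regions a S ->
  walk (adj a S) s t #|separating s t|.
Proof.
move=> sV tV; move: {2}#|_| (erefl #|separating s t|) => n.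
elim: n s sV => [|n IH] s sV E.
  by exists [::]; rewrite E (separating_eq0 sV tV E).
have st : s != t by apply: contra_eqN E => /eqP->; rewrite /separating eq_card0 // => i; rewrite !inE eqxx andbF.
have [r rV [i [iS si ri rj]]] := exists_adjacent arr sV tV st.
have F := separating_flip iS si ri rj.
have [|p [sp pp lp]] := IH r rV; first by apply/eqP; rewrite -eqSS -F E.
exists (r :: p); split; rewrite /= ?F ?sp // pp andbT.
by apply: adj_flip iS _ rj => //; rewrite ri.
Qed.

Lemma is_dist_separating s t n : s \in regions a S -> t \in regions a S ->
  is_dist (adj a S) s t n <-> n = #|separating s t|.
Proof.
move=> sV tV; have W := geodesic_exists sV tV.
have low k : walk (adj a S) s t k -> (#|separating s t| <= k)%N.
  by case=> p [<- pp <-]; apply: walk_lower_bound.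
split=> [[w H]|->]; last by split.
by apply/eqP; rewrite eqn_leq H // low.
Qed.

Variable B : {ffun 'I_m -> bool}.
Hypothesis BV : B \in regions a S.

Lemma rank_coverP s t : s \in regions a S -> t \in regions a S ->
  reflect (adj a S s t /\ (#|separating B s| < #|separating B t|)%N) (rank_cover (adj a S) B s t).
Proof.
move=> sV tV; apply: (iffP (asboolP _)) => [[st [n1 [n2 []]]]|[st l]].
  by move=> /(is_dist_separating _ BV sV)-> /(is_dist_separating _ BV tV)->.
split=> //; exists #|separating B s|, #|separating B t|.
by split=> //; apply/is_dist_separating.
Qed.

(** An edge changes one sign; changing it back to that of [B] would not increase the distance. *)
Lemma rank_cover_below s t : rank_cover (adj a S) B s t -> below B s t.
Proof.
move=> c; have [st _] := asboolP _ c; have /and3P[sV tV _] := st.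
have [_ l] := rank_coverP sV tV c; have [i [iS si tj]] := adjP st.
apply/belowP => j; have [-> sB|ji] := eqVneq j i; last by rewrite tj.
apply/eqP => tB; suff : (#|separating B t| <= #|separating B s|)%N by rewrite leqNgt l.
apply/subset_leq_card/subsetP => h; rewrite !inE => /andP[->] /=.
by have [->|hi] := eqVneq h i; rewrite ?tB ?eqxx // tj.
Qed.

Lemma rank_le_below : {in regions a S &, below B =2 rank_le (adj a S) B}.
Proof.
move=> s t sV tV; apply/idP/connectP => [|[p + ->]]; last first.
  elim: p s {sV} => [|r p IH] s /=; first by rewrite below_refl.
  by move=> /andP[/rank_cover_below sr /IH]; apply: below_trans.
suff: below B s t -> connect (rank_cover (adj a S) B) s t by move=> H /H/connectP.
move: {2}#|_| (erefl #|separating s t|) => n.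
elim: n s sV => [|n IH] s sV E st; first by rewrite (separating_eq0 sV tV E).
have neq : s != t.
  by apply: contra_eqN E => /eqP->; rewrite /separating eq_card0 // => i; rewrite !inE eqxx andbF.
have [r rV [i [iS si ri rj]]] := exists_adjacent arr sV tV neq.
(* As [s] is below [t], a hyperplane separating them has [s] on the side of [B], so crossing it goes
   up. *)
have sB : s i = B i.
  apply/eqP; apply: contraNT si => sB; have := belowP _ _ _ st i sB.
  by move: sB; case: (s i); case: (t i); case: (B i).
have F := separating_flip iS si ri rj.
apply: (connect_trans (y := r)).
  apply: connect1; apply/rank_coverP => //; split.
    by apply: adj_flip iS _ rj => //; rewrite ri.
  rewrite !(separatingC B) (@separating_flip r B s i) ?ri -?sB 1?eq_sym //.
  by move=> j ji; rewrite rj.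
apply: IH => //; first by apply/eqP; rewrite -eqSS -F E.
apply/belowP => j; have [->|ji] := eqVneq j i; first by rewrite ri.
by rewrite rj //; apply: (belowP _ _ _ st).
Qed.

End GraphDistance.

Theorem theorem1p2 (R : realType) (d m : nat) (a : 'I_m -> 'rV[R]_d)
    (ch : seq {set 'I_m}) (R0 : {ffun 'I_m -> bool}) :
  arrangement a ->
  ss_chain a [set: 'I_m] ch ->
  R0 \in regions a [set: 'I_m] ->
  canonical_region a [set: 'I_m] ch R0 ->
  let V := regions a [set: 'I_m] in
  let le := rank_le (adj a [set: 'I_m]) R0 in
  is_lattice V le /\
  (forall eqv : rel {ffun 'I_m -> bool},
     lattice_congruence V le eqv ->
     hamiltonian_path (classes V eqv) (qcover V le eqv)).
Proof.
move=> arr chain R0V can V le.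
have tw := chain_tower arr chain R0V can.
have E := rank_le_below arr R0V.
split; first exact: eq_in_lattice E (tower_lattice arr tw).
exact: tower_hamiltonian arr _ _ tw _ E.
Qed.
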